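(* Let $E$ be an algebraic vector bundle of rank $r$ on a smooth projective curve $C$ over $\mathbb C$, $\nabla:E\to E\otimes\Omega^1_C(D)$ a connection with poles along $D$, and $x\in D_{\rm ram}$. For a factorized $\nu$-ramified structure $(V_k,\vartheta_k,\varkappa_k)$ on $(E,\nabla)$ at $x$, regard $\overline V_k=V_k/z^{m-1}V_{k+1}$ as a $\mathbb C[w]/(w^{mr-r+1})$-module via $w\mapsto N_k$, let $\pi_k:V_k\otimes_{\mathbb C[z]/(z^m)}\mathbb C[w]/(w^{mr-r+1})\to\overline V_k$ be the surjection induced by $V_k\to\overline V_k$, let $\overline\iota_k:\overline V_k\to\overline V_{k-1}$ $(1\le k\le r-1)$ be induced by $V_k\subset V_{k-1}$, and let $\overline\iota_r:(z)/(z^{m+1})\otimes\overline V_0\to\overline V_{r-1}$ be induced by $(z)/(z^{m+1})\otimes V_0\to zV_0\subset V_{r-1}$. Then the correspondence $$(V_k,\vartheta_k,\varkappa_k)\mapsto(V_k,\overline V_k,\pi_k,\overline\iota_k)$$ gives a bijection between the set of equivalence classes of factorized $\nu$-ramified structures on $(E,\nabla)$ at $x$ and the set of isomorphism (equivalence) classes of generic $\nu$-ramified structures on $(E,\nabla)$ at $x$.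
   Context: **Setting.** $C$ is a smooth projective curve over $\mathbb C$, $D$ an effective divisor on $C$ and $x\in D_{\rm ram}$ a point of $D$ of multiplicity $m=m_x\ge2$; $z$ is a generator of the maximal ideal of $\mathcal O_{C,x}$, $w$ a variable with $w^r=z$; $\nu(w)=\sum_{k=0}^{r-1}\nu_k(z)w^k$ with $\nu_0\in\Omega^1_C(D)|_{mx}$, $\nu_k\in\Omega^1_C(D)|_{(m-1)x}$ for $1\le k\le r-1$, the leading coefficient of $\nu_1$ being nonzero. $\nabla|_{mx}:E|_{mx}\to E\otimes\Omega^1_C(D)|_{mx}$ is the $\mathcal O_{mx}$-linear map induced by $\nabla$. $R=\mathbb C[w]/(w^{mr-r+1})$ is an algebra over $\mathcal O_{mx}=\mathbb C[z]/(z^m)$ via $z=w^r$. Symbols such as $(w^a)/(w^b)$ denote subquotients of $\mathbb C[w]$ by ideals, $(z)=(w^r)$. **Generic $\nu$-ramified structure on $(E,\nabla)$ at $x$**: a tuple $((V_k,L_k,\pi_k)_{0\le k\le r-1},(\phi_k)_{1\le k\le r})$ such that (i) $E|_{mx}=V_0\supset V_1\supset\cdots\supset V_{r-1}\supset V_r=zV_0$ is a filtration by $\mathcal O_{mx}$-submodules with $\mathrm{length}(V_k/V_{k+1})=1$ and $\nabla|_{mx}(V_k)\subset V_k\otimes\Omega^1_C(D)|_{mx}$; (ii) $\pi_k:V_k\otimes_{\mathcal O_{mx}}R\to L_k$ is a quotient free $R$-module of rank one, the restriction $\pi_k|_{V_k}:V_k\to L_k$ is surjective, and $(\pi_k\otimes1)\circ(\nabla|_{mx}\otimes\mathrm{id}_R)=(\nu(w)+\frac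 kr\frac{dz}z)\circ\pi_k$; (iii) $\phi_k:L_k\to wL_{k-1}$ ($1\le k\le r-1$) and $\phi_r:(z)/(w^{mr+1})\otimes_{\mathbb C[w]}L_0=(z)/(z^{m+1})\otimes L_0\to wL_{r-1}$ are surjective $\mathbb C[w]$-homomorphisms with $\phi_k\circ\pi_k=\pi_{k-1}|_{V_k\otimes R}$ (restriction along the map $V_k\otimes R\to V_{k-1}\otimes R$ induced by inclusion) and $\phi_r\circ(1\otimes\pi_0)=\pi_{r-1}\circ c$, where $c:(z)/(z^{m+1})\otimes V_0\otimes R\to V_{r-1}\otimes R$ is induced by $zV_0\subset V_{r-1}$; (iv) there are $\mathbb C[w]$-isomorphisms $\psi_k:L_k\to(w)/(w^{mr-r+2})\otimes L_{k-1}$ ($1\le k\le r-1$) whose composites with $(w)/(w^{mr-r+2})\otimes L_{k-1}\to wL_{k-1}$ are $\phi_k$, and such that $(z)/(w^{mr+1})\otimes L_0\xrightarrow{\phi_r}L_{r-1}\xrightarrow{\psi_{r-1}}\cdots\xrightarrow{\psi_1}((w)/(w^{mr-r+2}))^{\otimes(r-1)}\otimes L_0\cong(w^{r-1})/(w^{mr})\otimes L_0$ is obtained by tensoring $L_0$ with the canonical map $(z)/(w^{mr+1})\to(w^{r-1})/(w^{mr})$. Two such structures $(V_k,L_k,\pi_k,\phi_k)$, $(V'_k,L'_k,\pi'_k,\phi'_k)$ are equivalent if $V_k=V'_k$ for all $k$ and there are $\mathbb C[w]$-isomorphisms $\sigma_k:L_k\to L'_k$ with $\sigma_k\circ\pi_k|_{V_k}=\pi'_k|_{V_k}$,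 $\sigma_{k-1}\phi_k=\phi'_k\sigma_k$ ($1\le k\le r-1$) and $\sigma_{r-1}\phi_r=\phi'_r(\mathrm{id}\otimes\sigma_0)$. **Factorized $\nu$-ramified structure on $(E,\nabla)$ at $x$**: a tuple $(V_k,\vartheta_k,\varkappa_k)_{0\le k\le r-1}$ such that (i) the $V_k$ satisfy condition (i) above. Put $\overline V_k=V_k/z^{m-1}V_{k+1}$ and $\overline W_k=\mathrm{Hom}_{\mathcal O_{mx}}(\overline V_{r-k-1},\mathcal O_{mx})$. There are canonical maps $\overline V_k\to\overline V_{k-1}$ (induced by inclusion) and $(z)/(z^{m+1})\otimes\overline V_0\to\overline V_{r-1}$ (induced by $zV_0\subset V_{r-1}$), and dually $\overline W_k\to\overline W_{k-1}$ (dual of $\overline V_{r-k}\to\overline V_{r-k-1}$) and $(z)/(z^{m+1})\otimes\overline W_0\to\overline W_{r-1}$ (obtained by tensoring with $(z)/(z^{m+1})$ the dual of $(z)/(z^{m+1})\otimes\overline V_0\to\overline V_{r-1}$); (ii) $\vartheta_k:\overline W_k\times\overline W_{r-k-1}\to\mathcal O_{mx}$ are $\mathcal O_{mx}$-bilinear with $\vartheta_k(v,v')=\vartheta_{r-k-1}(v',v)$, and the induced $\theta_k:\overline W_k\to\mathrm{Hom}(\overline W_{r-k-1},\mathcal O_{mx})=\overline V_k$ are isomorphisms commuting with the canonical maps (with $1\otimes\theta_0$ on $(z)/(z^{m+1})\otimes\overline W_0$); (iii) $\varkappa_k:\overline V_k\times\overline V_{r-k-1}\to\mathcal O_{mx}$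 are $\mathcal O_{mx}$-bilinear with $\varkappa_k(v,v')=\varkappa_{r-k-1}(v',v)$, and the induced $\kappa_k:\overline V_k\to\overline W_k$ commute with the canonical maps; (iv) $N_k:=\theta_k\circ\kappa_k$ satisfies $N_k^r=z\,\mathrm{id}$ and $N_k^{mr-r+1}=0$, the induced ring homomorphism $R\to\mathrm{End}_{\mathcal O_{mx}}(\overline V_k)$, $f(w)\mapsto f(N_k)$, is injective, and $V_k\to\overline V_k$ intertwines $\nabla|_{mx}$ with $\nu(N_k)+\frac kr\frac{dz}z$; (v) for the $\mathbb C[w]$-module structure on $\overline V_k$ given by $N_k$, there are $\mathbb C[w]$-isomorphisms $\psi_k:\overline V_k\to(w)/(w^{mr-r+2})\otimes\overline V_{k-1}$ whose composites with $(w)/(w^{mr-r+2})\otimes\overline V_{k-1}\to w\overline V_{k-1}\subset\overline V_{k-1}$ are the canonical maps, and such that $(z)/(z^{m+1})\otimes\overline V_0\to\overline V_{r-1}\xrightarrow{\psi_{r-1}}\cdots\xrightarrow{\psi_1}(w^{r-1})/(w^{mr})\otimes\overline V_0$ is obtained from the canonical map $(z)/(z^{m+1})\to(w^{r-1})/(w^{mr})$. Two such structures $(V_k,\vartheta_k,\varkappa_k)$, $(V'_k,\vartheta'_k,\varkappa'_k)$ are equivalent if $V_k=V'_k$, $N_k=N'_k$ for all $k$ and there are isomorphisms $\varsigma_k:\overline W_k\to\overline W_k$ with ${}^tN_{r-k-1}\varsigma_k=\varsigma_k{}^tN_{r-k-1}$, $\theta'_k=\theta_k\varsigma_k$, $\kappa'_k=\varsigma_k^{-1}\kappa_k$,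 commuting with the canonical maps $\overline W_k\to\overline W_{k-1}$ and $(z)/(z^{m+1})\otimes\overline W_0\to\overline W_{r-1}$. *)

(* Defs.v *)
From HB Require Import structures.
From mathcomp Require Import all_boot all_order all_algebra.
From mathcomp Require Import generic_quotient ring_quotient.
From mathcomp Require Import boolp classical_sets cardinality.
Set Implicit Arguments.
Unset Strict Implicit.
Unset Printing Implicit Defensive.
Import GRing.Theory.
Local Open Scope ring_scope.
Local Open Scope quotient_scope.

Set Warnings "-redundant-canonical-projection,-projection-no-head-constant".

(* Conventions.  Modules over O_mx = F[z]/(z^m) and over R = F[w]/(w^n),
   n = mr - r + 1, are treated as modules over the polynomial rings F[z] and
   F[w], both written {poly F}; Hom and tensor products of modules killed by
   z^m (resp. w^n) are the same over F[z] as over O_mx (resp. over F[w] as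
   over R).  F[w] is an F[z]-algebra through [zw : p(z) |-> p(w^r)].

   Maps out of quotients and tensor products ([rep], [tlift]) are total
   functions computed on representatives; they are the induced maps whenever
   the given map is compatible with the relations. *)

Record submodule (A : comNzRingType) (M : lmodType A) := Submodule {
  submodule_pred :> {pred M};
  submoduleP : submod_closed submodule_pred }.

HB.instance Definition _ (A : comNzRingType) (M : lmodType A)
    (V : submodule M) :=
  GRing.isSubmodClosed.Build A M (submodule_pred V)
    (GRing.submod_closed_semi (submoduleP V)).

Definition subm (A : comNzRingType) (M : lmodType A) (V : submodule M) : Type :=
  {x : M | x \in submodule_pred V}.

HB.instance Definition _ (A : comNzRingType) (M : lmodType A)
    (V : submodule M) := SubChoice.on (subm V).
HB.instance Definition _ (A : comNzRingType) (M : lmodType A)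
    (V : submodule M) :=
  GRing.SubChoice_isSubLmodule.Build A M _ (subm V)
    (GRing.submod_closed_semi (submoduleP V)).

(* Junk value 0 when x is not in V. *)
Definition tosubm (A : comNzRingType) (M : lmodType A) (V : submodule M)
    (x : M) : subm V := insubd 0 x.

Section Quot.
Variables (A : comNzRingType) (M : lmodType A).
Implicit Types V S : submodule M.

Fact relative_submod_closed V S :
  submod_closed [pred x : subm V | val x \in S].
Proof.
split=> [|a x y]; rewrite !inE; first by rewrite raddf0 rpred0.
by move=> xS yS; rewrite GRing.valD GRing.valZ rpredD // rpredZ.
Qed.

Definition relative V S : submodule (subm V) :=
  Submodule (relative_submod_closed V S).

(* V / (V :&: S) *)
Definition subquot V S : Type := Quotient.quot (relative V S).

HB.instance Definition _ V S := GRing.Zmodule.on (subquot V S).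

Definition subquot_pi V S : subm V -> subquot V S :=
  \pi_(Quotient.quot (relative V S)).
Definition subquot_repr V S (q : subquot V S) : subm V :=
  repr (q : Quotient.quot (relative V S)).

Lemma subquot_reprK V S : cancel (@subquot_repr V S) (@subquot_pi V S).
Proof. exact: reprK. Qed.

Lemma subquot_piD V S : {morph @subquot_pi V S : x y / x + y}.
Proof. by move=> x y; rewrite /subquot_pi raddfD. Qed.

Lemma subquot_pi_eq V S (x y : subm V) :
  (subquot_pi S x == subquot_pi S y) = (val x - val y \in S).
Proof.
have -> : val x - val y = val (x - y) by rewrite GRing.valB.
exact/esym/(Quotient.idealrBE (relative V S)).
Qed.

Definition subquot_scale V S (a : A) (q : subquot V S) : subquot V S :=
  subquot_pi S (a *: subquot_repr q).

Lemma subquot_scaleE V S a (x : subm V) :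
  subquot_scale a (subquot_pi S x) = subquot_pi S (a *: x).
Proof.
apply/eqP; rewrite subquot_pi_eq !GRing.valZ -scalerBr rpredZ //.
by rewrite -subquot_pi_eq subquot_reprK.
Qed.

Fact subquot_scaleA V S a b (q : subquot V S) :
  subquot_scale a (subquot_scale b q) = subquot_scale (a * b) q.
Proof. by rewrite -[q]subquot_reprK !subquot_scaleE scalerA. Qed.
Fact subquot_scale1 V S : left_id 1 (@subquot_scale V S).
Proof. by move=> q; rewrite -[q]subquot_reprK subquot_scaleE scale1r. Qed.
Fact subquot_scaleDr V S : right_distributive (@subquot_scale V S) +%R.
Proof.
move=> a q q'; rewrite -[q]subquot_reprK -[q']subquot_reprK.
by rewrite !(subquot_scaleE, =^~ subquot_piD) scalerDr.
Qed.
Fact subquot_scaleDl V S (q : subquot V S) :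
  {morph (@subquot_scale V S)^~ q : a b / a + b}.
Proof.
move=> a b; rewrite -[q]subquot_reprK.
by rewrite !(subquot_scaleE, =^~ subquot_piD) scalerDl.
Qed.
HB.instance Definition _ V S := GRing.Zmodule_isLmodule.Build A (subquot V S)
  (@subquot_scaleA V S) (@subquot_scale1 V S) (@subquot_scaleDr V S)
  (@subquot_scaleDl V S).

(* Class in V / S of an element x of V. *)
Definition cls V S (x : M) : subquot V S := subquot_pi S (tosubm V x).
Definition rep V S (q : subquot V S) : M := val (subquot_repr q).
End Quot.

Section Hom.
Variables (A : comNzRingType) (M N : lmodType A).

Record linmap : Type := Linmap { hom_fun :> M -> N; homP : linear hom_fun }.
HB.instance Definition _ (f : linmap) :=
  GRing.isLinear.Build A M N *:%R (hom_fun f) (homP f).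

Lemma hom_ext (f g : linmap) : f =1 g -> f = g.
Proof.
case: f g => f fP [g gP] /= fg.
by have e : f = g := funext fg; subst g; congr Linmap; apply: Prop_irrelevance.
Qed.

HB.instance Definition _ := gen_eqMixin linmap.
HB.instance Definition _ := gen_choiceMixin linmap.

Fact hom0_subproof : linear (fun _ : M => 0 : N).
Proof. by move=> a x y; rewrite scaler0 addr0. Qed.
Fact homD_subproof (f g : linmap) : linear (fun x => f x + g x).
Proof. by move=> a x y; rewrite !linearP scalerDr addrACA. Qed.
Fact homN_subproof (f : linmap) : linear (fun x => - f x).
Proof. by move=> a x y; rewrite linearP opprD scalerN. Qed.
Fact homZ_subproof a (f : linmap) : linear (fun x => a *: f x).
Proof. by move=> b x y; rewrite linearP scalerDr !scalerA mulrC. Qed.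

Definition hom0 := Linmap hom0_subproof.
Definition homD f g := Linmap (homD_subproof f g).
Definition homN f := Linmap (homN_subproof f).
Definition homZ a f := Linmap (homZ_subproof a f).

Fact homDA : associative homD.
Proof. by move=> f g h; apply: hom_ext => x /=; rewrite addrA. Qed.
Fact homDC : commutative homD.
Proof. by move=> f g; apply: hom_ext => x /=; rewrite addrC. Qed.
Fact hom0D : left_id hom0 homD.
Proof. by move=> f; apply: hom_ext => x /=; rewrite add0r. Qed.
Fact homND : left_inverse hom0 homN homD.
Proof. by move=> f; apply: hom_ext => x /=; rewrite addNr. Qed.
HB.instance Definition _ := GRing.isZmodule.Build linmap homDA homDC hom0D homND.

Fact homZA a b f : homZ a (homZ b f) = homZ (a * b) f.
Proof. by apply: hom_ext => x /=; rewrite scalerA. Qed.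
Fact hom1Z : left_id 1 homZ.
Proof. by move=> f; apply: hom_ext => x /=; rewrite scale1r. Qed.
Fact homZDr : right_distributive homZ +%R.
Proof. by move=> a f g; apply: hom_ext => x /=; rewrite scalerDr. Qed.
Fact homZDl f : {morph homZ^~ f : a b / a + b}.
Proof. by move=> a b; apply: hom_ext => x /=; rewrite scalerDl. Qed.
HB.instance Definition _ :=
  GRing.Zmodule_isLmodule.Build A linmap homZA hom1Z homZDr homZDl.

(* f itself when f is linear, 0 otherwise. *)
Definition homof (f : M -> N) : linmap :=
  if pselect (linear f) is left fP then Linmap fP else 0.
End Hom.

Section Tensor.
Variables (A : comNzRingType) (M N : lmodType A).

Definition bilinear_map (P : lmodType A) (b : M -> N -> P) : Prop :=
  (forall n, linear (b^~ n)) /\ (forall m, linear (b m)).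

Definition formal_sum (P : lmodType A) (b : M -> N -> P) (s : seq (M * N)) : P :=
  \sum_(q <- s) b q.1 q.2.

(* Two formal sums of pairs (m, n) represent the same tensor when no bilinear
   map distinguishes them. *)
Definition tensor_rel (s t : seq (M * N)) : bool :=
  `[< forall (P : lmodType A) (b : M -> N -> P),
        bilinear_map b -> formal_sum b s = formal_sum b t >].

Fact tensor_rel_equiv : equiv_class_of tensor_rel.
Proof.
split=> [s|s t|t s u]; first exact/asboolP.
  by apply/asboolP/asboolP => h P b /h.
move=> /asboolP st /asboolP tu; apply/asboolP => P b hb.
by rewrite st ?tu.
Qed.
Canonical tensor_equiv := EquivRelPack tensor_rel_equiv.

Definition tensor : Type := {eq_quot tensor_equiv}.
HB.instance Definition _ := Choice.on tensor.

Definition tensor_pi (s : seq (M * N)) : tensor :=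
  \pi_({eq_quot tensor_equiv}) s.
Definition tensor_repr (t : tensor) : seq (M * N) :=
  repr (t : {eq_quot tensor_equiv}).

Lemma tensor_reprK : cancel tensor_repr tensor_pi.
Proof. exact: reprK. Qed.

Lemma tensor_piP s t : tensor_pi s = tensor_pi t <->
  forall (P : lmodType A) (b : M -> N -> P),
    bilinear_map b -> formal_sum b s = formal_sum b t.
Proof.
split=> [/eqmodP/asboolP //|h]; by apply/eqmodP/asboolP.
Qed.

Definition tlift (P : lmodType A) (b : M -> N -> P) (t : tensor) : P :=
  formal_sum b (tensor_repr t).

Lemma tlift_pi (P : lmodType A) (b : M -> N -> P) s :
  bilinear_map b -> tlift b (tensor_pi s) = formal_sum b s.
Proof.
have /tensor_piP h : tensor_pi (tensor_repr (tensor_pi s)) = tensor_pi s.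
  by rewrite tensor_reprK.
exact: h.
Qed.

Lemma tensor_ext (s t : tensor) :
  (forall (P : lmodType A) (b : M -> N -> P),
     bilinear_map b -> tlift b s = tlift b t) -> s = t.
Proof.
move=> h; rewrite -[s]tensor_reprK -[t]tensor_reprK; apply/tensor_piP.
exact: h.
Qed.

Definition tensor_scale (a : A) (t : tensor) : tensor :=
  tensor_pi [seq (a *: q.1, q.2) | q <- tensor_repr t].
Definition tensor_add (s t : tensor) : tensor :=
  tensor_pi (tensor_repr s ++ tensor_repr t).
Definition tensor_opp (t : tensor) : tensor :=
  tensor_pi [seq (- q.1, q.2) | q <- tensor_repr t].

Section LiftOps.
Variables (P : lmodType A) (b : M -> N -> P) (hb : bilinear_map b).

Lemma tlift_scale_subproof a t : tlift b (tensor_scale a t) = a *: tlift b t.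
Proof.
rewrite tlift_pi // /formal_sum big_map scaler_sumr.
by apply: eq_bigr => q _; apply: (linearZ_LR (Linmap (hb.1 q.2))).
Qed.
Lemma tlift_add_subproof s t :
  tlift b (tensor_add s t) = tlift b s + tlift b t.
Proof. by rewrite tlift_pi // /formal_sum big_cat. Qed.
Lemma tlift_opp_subproof t : tlift b (tensor_opp t) = - tlift b t.
Proof.
rewrite tlift_pi // /formal_sum big_map -sumrN.
by apply: eq_bigr => q _; apply: (raddfN (Linmap (hb.1 q.2))).
Qed.
Lemma tlift0_subproof : tlift b (tensor_pi [::]) = 0.
Proof. by rewrite tlift_pi // /formal_sum big_nil. Qed.
End LiftOps.

Definition tlift_ops := (tlift_scale_subproof, tlift_add_subproof,
  tlift_opp_subproof, tlift0_subproof).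

Fact tensor_addA : associative tensor_add.
Proof. by move=> s t u; apply: tensor_ext => P b hb; rewrite !tlift_ops // addrA. Qed.
Fact tensor_addC : commutative tensor_add.
Proof. by move=> s t; apply: tensor_ext => P b hb; rewrite !tlift_ops // addrC. Qed.
Fact tensor_add0 : left_id (tensor_pi [::]) tensor_add.
Proof. by move=> s; apply: tensor_ext => P b hb; rewrite !tlift_ops // add0r. Qed.
Fact tensor_addN : left_inverse (tensor_pi [::]) tensor_opp tensor_add.
Proof. by move=> s; apply: tensor_ext => P b hb; rewrite !tlift_ops // addNr. Qed.
HB.instance Definition _ := GRing.isZmodule.Build tensor
  tensor_addA tensor_addC tensor_add0 tensor_addN.

Fact tensor_scaleA a c t :
  tensor_scale a (tensor_scale c t) = tensor_scale (a * c) t.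
Proof. by apply: tensor_ext => P b hb; rewrite !tlift_ops // scalerA. Qed.
Fact tensor_scale1 : left_id 1 tensor_scale.
Proof. by move=> t; apply: tensor_ext => P b hb; rewrite !tlift_ops // scale1r. Qed.
Fact tensor_scaleDr : right_distributive tensor_scale +%R.
Proof.
by move=> a s t; apply: tensor_ext => P b hb; rewrite !tlift_ops // scalerDr.
Qed.
Fact tensor_scaleDl t : {morph tensor_scale^~ t : a c / a + c}.
Proof.
by move=> a c; apply: tensor_ext => P b hb; rewrite !tlift_ops // scalerDl.
Qed.
HB.instance Definition _ := GRing.Zmodule_isLmodule.Build A tensor
  tensor_scaleA tensor_scale1 tensor_scaleDr tensor_scaleDl.

Definition tens (m : M) (n : N) : tensor := tensor_pi [:: (m, n)].

(* [tliftE], [tlift_linear], [tens_bilinear], [tensor_sum]: universal property. *)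
Lemma tliftE (P : lmodType A) (b : M -> N -> P) m n :
  bilinear_map b -> tlift b (tens m n) = b m n.
Proof. by move=> hb; rewrite tlift_pi // /formal_sum big_seq1. Qed.

Lemma tlift_linear (P : lmodType A) (b : M -> N -> P) :
  bilinear_map b -> linear (tlift b).
Proof. by move=> hb a s t; rewrite !tlift_ops. Qed.

Lemma tens_bilinear : bilinear_map tens.
Proof.
split=> [n a m m'|m a n n']; apply: tensor_ext => P b hb;
  rewrite !tlift_ops // !tliftE //; [exact: hb.1 | exact: hb.2].
Qed.

Lemma tensor_sum (t : tensor) : t = \sum_(q <- tensor_repr t) tens q.1 q.2.
Proof.
rewrite -[LHS]tensor_reprK; move: (tensor_repr t) => s.
elim: s => [|q s IH]; first by rewrite big_nil.
rewrite big_cons -IH; apply: tensor_ext => P b hb.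
rewrite tlift_ops // tliftE // !tlift_pi //.
by rewrite /formal_sum big_cons.
Qed.
End Tensor.

Notation "u ⊗ v" := (tens u v) (at level 40, left associativity).

Definition tmap (A : comNzRingType) (M N M' N' : lmodType A)
    (f : M -> M') (g : N -> N') : tensor M N -> tensor M' N' :=
  tlift (fun m n => f m ⊗ g n).

Section Restriction.
Variables (A B : comNzRingType) (h : {rmorphism A -> B}) (M : lmodType B).

(* The type M with scalars restricted along h; the argument only serves
   instance resolution. *)
Definition restr (h' : {rmorphism A -> B}) : Type := M.
HB.instance Definition _ := GRing.Zmodule.on (restr h).

Definition restr_scale (a : A) (x : restr h) : restr h := h a *: (x : M).
Fact restr_scaleA a b x : restr_scale a (restr_scale b x) = restr_scale (a * b) x.
Proof. by rewrite /restr_scale scalerA rmorphM. Qed.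
Fact restr_scale1 : left_id 1 restr_scale.
Proof. by move=> x; rewrite /restr_scale rmorph1 scale1r. Qed.
Fact restr_scaleDr : right_distributive restr_scale +%R.
Proof. by move=> a x y; rewrite /restr_scale [LHS]scalerDr. Qed.
Fact restr_scaleDl x : {morph restr_scale^~ x : a b / a + b}.
Proof. by move=> a b; rewrite /restr_scale rmorphD [LHS]scalerDl. Qed.
HB.instance Definition _ := GRing.Zmodule_isLmodule.Build A (restr h)
  restr_scaleA restr_scale1 restr_scaleDr restr_scaleDl.
End Restriction.

Section BaseChange.
Variables (A B : comNzRingType) (h : {rmorphism A -> B}).
Variables (M : lmodType A) (Q : lmodType B).

(* M ⊗_A Q as a B-module. *)
Definition btensor : Type := tensor M (restr Q h).
HB.instance Definition _ := GRing.Zmodule.on btensor.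

Definition btens (m : M) (q : Q) : btensor := m ⊗ (q : restr Q h).

Definition btensor_scale (f : B) (t : btensor) : btensor :=
  tmap id (fun q : restr Q h => f *: (q : Q) : restr Q h) t.

Fact btensor_scale_bilinear (f : B) :
  bilinear_map (fun (m : M) (q : restr Q h) => m ⊗ (f *: (q : Q) : restr Q h)).
Proof.
split=> [q a m m'|m a q q']; first exact: (tens_bilinear _ _).1.
rewrite -(tens_bilinear _ _).2; congr (_ ⊗ _).
rewrite [X in f *: X]/GRing.add [LHS]scalerDr; congr (_ + _).
by rewrite [X in f *: X]/GRing.scale [RHS]/GRing.scale /= /restr_scale /= !scalerA mulrC.
Qed.

Lemma btensor_scaleE f m q : btensor_scale f (btens m q) = btens m (f *: q).
Proof. by rewrite /btensor_scale /tmap tliftE //; apply: btensor_scale_bilinear. Qed.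

Lemma btensor_scaleD f : {morph btensor_scale f : s t / s + t}.
Proof.
by move=> s t; have := tlift_linear (btensor_scale_bilinear f) 1 s t; rewrite !scale1r.
Qed.

Lemma btensor_ind (P : btensor -> Prop) :
  P 0 -> (forall m q t, P t -> P (btens m q + t)) -> forall t, P t.
Proof.
move=> P0 PS t; rewrite [t]tensor_sum; elim: (tensor_repr t) => [|[m q] s IH].
  by rewrite big_nil.
by rewrite big_cons; apply: PS.
Qed.

Lemma btensor_scale0 f : btensor_scale f 0 = 0.
Proof. by apply: (addrI (btensor_scale f 0)); rewrite -btensor_scaleD !addr0. Qed.

Fact btensor_scaleA f g t :
  btensor_scale f (btensor_scale g t) = btensor_scale (f * g) t.
Proof.
elim/btensor_ind: t => [|m q t IH]; first by rewrite !btensor_scale0.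
by rewrite !btensor_scaleD !btensor_scaleE IH scalerA.
Qed.
Fact btensor_scale1 : left_id 1 btensor_scale.
Proof.
elim/btensor_ind => [|m q t IH]; first by rewrite btensor_scale0.
by rewrite btensor_scaleD btensor_scaleE IH scale1r.
Qed.
Fact btensor_scaleDl t : {morph btensor_scale^~ t : f g / f + g}.
Proof.
move=> f g; elim/btensor_ind: t => [|m q t IH].
  by rewrite !btensor_scale0 addr0.
rewrite !btensor_scaleD !btensor_scaleE IH scalerDl addrACA; congr (_ + _).
have := (tens_bilinear _ _).2 m 1 (f *: q : restr Q h) (g *: q : restr Q h).
by rewrite !scale1r.
Qed.
HB.instance Definition _ := GRing.Zmodule_isLmodule.Build B btensor
  btensor_scaleA btensor_scale1 btensor_scaleD btensor_scaleDl.
End BaseChange.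

Section PolyMod.
Variables (F : fieldType) (U : lmodType {poly F}) (N : linmap U U).

(* p(N) u *)
Definition polyact (p : {poly F}) (u : U) : U :=
  \sum_(i < size p) (p`_i)%:P *: iter i N u.

Lemma polyactE n (p : {poly F}) u : (size p <= n)%N ->
  polyact p u = \sum_(i < n) (p`_i)%:P *: iter i N u.
Proof.
move=> le_n; rewrite /polyact (big_ord_widen n (fun i => (p`_i)%:P *: iter i N u)) //.
rewrite big_mkcond; apply: eq_bigr => i _; case: ltnP => // /(nth_default 0) ->.
by rewrite polyC0 scale0r.
Qed.

Fact iter_homD i u v : iter i N (u + v) = iter i N u + iter i N v.
Proof. by elim: i => // i IH; rewrite !iterS IH raddfD. Qed.
Fact iter_homZ i p u : iter i N (p *: u) = p *: iter i N u.
Proof. by elim: i => // i IH; rewrite !iterS IH linearZ. Qed.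

Fact polyactDl u : {morph polyact^~ u : p q / p + q}.
Proof.
move=> p q; pose n := maxn (size p) (size q).
rewrite !(@polyactE n) ?size_polyD ?leq_maxl ?leq_maxr // -big_split /=.
by apply: eq_bigr => i _; rewrite coefD polyCD scalerDl.
Qed.
Fact polyactDr : right_distributive polyact +%R.
Proof.
move=> p u v; rewrite /polyact -big_split /=; apply: eq_bigr => i _.
by rewrite iter_homD scalerDr.
Qed.
Lemma polyactC c u : polyact c%:P u = c%:P *: u.
Proof. by rewrite (@polyactE 1) ?size_polyC_leq1 // big_ord1 coefC. Qed.
Lemma polyactX u : polyact 'X u = N u.
Proof.
by rewrite /polyact size_polyX !big_ord_recr big_ord0 /= !coefX /= polyC0 scale0r !add0r scale1r.
Qed.
Lemma polyact_homC p u : polyact p (N u) = N (polyact p u).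
Proof.
rewrite /polyact raddf_sum; apply: eq_bigr => i _ /=.
by rewrite linearZ /= -iterSr.
Qed.
Lemma polyactMX p u : polyact (p * 'X) u = polyact p (N u).
Proof.
rewrite (@polyactE (size p).+1) ?size_polyMX_leq //; last first.
  by apply: (leq_trans (size_polyMleq _ _)); rewrite size_polyX addn2.
rewrite big_ord_recl coefMX polyC0 scale0r add0r; apply: eq_bigr => i _.
by rewrite coefMX /= -iterSr.
Qed.
Lemma polyactCM c p u : polyact (c%:P * p) u = c%:P *: polyact p u.
Proof.
rewrite (@polyactE (size p)); last first.
  by rewrite mul_polyC size_scale_leq.
rewrite /polyact scaler_sumr; apply: eq_bigr => i _.
by rewrite coefCM polyCM scalerA.
Qed.
Lemma polyactZ p q u : polyact p (q *: u) = q *: polyact p u.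
Proof.
rewrite /polyact scaler_sumr; apply: eq_bigr => i _.
by rewrite iter_homZ !scalerA mulrC.
Qed.

Fact polyactA p q u : polyact p (polyact q u) = polyact (p * q) u.
Proof.
elim/poly_ind: p u => [|p c IH] u.
  by rewrite mul0r /polyact !size_poly0 !big_ord0.
rewrite mulrDl !polyactDl polyactC polyactCM -mulrA ['X * q]mulrC mulrA.
by rewrite !polyactMX -IH [polyact q (N u)]polyact_homC.
Qed.
Fact polyact1 : left_id 1 polyact.
Proof. by move=> u; rewrite polyactC scale1r. Qed.

(* U as an F[w]-module with w acting as N. *)
Definition polymod (N' : linmap U U) : Type := U.
HB.instance Definition _ := GRing.Zmodule.on (polymod N).
HB.instance Definition _ := GRing.Zmodule_isLmodule.Build {poly F} (polymod N)
  polyactA polyact1 polyactDr polyactDl.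
End PolyMod.

Definition homcomp (A : comNzRingType) (M N P : lmodType A)
    (g : linmap N P) (f : linmap M N) : linmap M P := homof (g \o f).

Section Submodules.
Variables (A : comNzRingType) (M : lmodType A).

Fact scaled_submod_closed (a : A) (V : submodule M) :
  submod_closed [pred x : M | `[< exists2 y, y \in V & x = a *: y >]].
Proof.
split=> [|b x y]; rewrite !inE; first by exists 0; rewrite ?rpred0 ?scaler0.
move=> [u uV ->] [v vV ->]; exists (b *: u + v); first by rewrite rpredD // rpredZ.
by rewrite scalerDr !scalerA mulrC.
Qed.
(* a V *)
Definition scaled (a : A) (V : submodule M) : submodule M :=
  Submodule (scaled_submod_closed a V).

Definition strict_chain (c : nat -> submodule M) (n : nat) : Prop :=
  forall i, (i < n)%N ->
    {subset c i <= c i.+1} /\ (exists2 y, y \in c i.+1 & y \notin c i).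
Definition has_length (n : nat) : Prop :=
  (exists c, strict_chain c n) /\
  (forall c n', strict_chain c n' -> (n' <= n)%N).
End Submodules.

Section Geometry.
Variable F : fieldType.

(* A smooth projective (irreducible) curve over F, given as an abstract
   nonsingular curve (Hartshorne, I.6): its function field K is finite over
   F(t) with t transcendental, and its closed points are the normalized
   discrete valuations of K that are trivial on F.  [ord_residue] says that
   the residue field is F, which is automatic when F is algebraically closed;
   ord 0 is normalized to 0 so that a closed point is determined by
   its valuation. *)
Record curve := Curve {
  rational :> fieldType;
  cst : {rmorphism F -> rational};
  curve_transcendence1 :
    exists (t : rational) (n : nat) (b : 'I_n -> rational),
      (forall p : {poly F}, (map_poly cst p).[t] = 0 -> p = 0) /\
      (forall f, exists (q : {poly F}) (p : 'I_n -> {poly F}), q != 0 /\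
         (map_poly cst q).[t] * f = \sum_i (map_poly cst (p i)).[t] * b i) }.

Variable X : curve.

Record closed_point := Point {
  ord : X -> int;
  ord0 : ord 0 = 0;
  ord_cst : forall c : F, ord (cst X c) = 0;
  ordM : forall f g : X, f != 0 -> g != 0 -> ord (f * g) = ord f + ord g;
  ordD : forall f g : X, f != 0 -> g != 0 -> f + g != 0 ->
    Num.min (ord f) (ord g) <= ord (f + g);
  ord_onto : exists f, ord f = 1;
  ord_residue : forall f : X, f != 0 -> 0 <= ord f ->
    exists c : F, f = cst X c \/ 0 < ord (f - cst X c) }.

(* f lies in the n-th power of the maximal ideal at p. *)
Definition ord_ge (p : closed_point) (n : int) (f : X) : bool :=
  (f == 0) || (n <= ord p f).
Definition regular (p : closed_point) (f : X) : bool := ord_ge p 0 f.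

Record effective_divisor := EffectiveDivisor {
  mult :> closed_point -> nat;
  mult_finite : finite_set [set p | mult p != 0%N]%classic }.

Definition derivation (M : lmodType X) (d : X -> M) : Prop :=
  [/\ forall f g, d (f + g) = d f + d g,
      forall f g, d (f * g) = f *: d g + g *: d f
    & forall c : F, d (cst X c) = 0].

(* The K-space of rational differentials, by its universal property. *)
Record kaehler := Kaehler {
  form :> lmodType X;
  kd : X -> form;
  kd_derivation : derivation kd;
  kd_universal : forall (M : lmodType X) (d : X -> M), derivation d ->
    exists! h : linmap form M, forall f, d f = h (kd f) }.

Variables (D : effective_divisor) (Om : kaehler).

(* Stalks at p of Ω^1 and Ω^1(D), inside the rational differentials. *)
Definition regular_form (p : closed_point) (w : Om) : Prop :=
  exists s : seq (X * X),
    (forall q, q \in s -> regular p q.1 && regular p q.2) /\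
    w = \sum_(q <- s) q.1 *: kd Om q.2.
Definition polar_form (p : closed_point) (w : Om) : Prop :=
  forall f : X, ord_ge p (D p) f -> regular_form p (f *: w).

Definition is_basis (M : lmodType X) (r : nat) (b : 'I_r -> M) : Prop :=
  forall v, exists! c : {ffun 'I_r -> X}, v = \sum_i c i *: b i.
Definition lattice (M : lmodType X) (r : nat) (b : 'I_r -> M) (p : closed_point)
    (v : M) : Prop :=
  exists c : 'I_r -> X, (forall i, regular p (c i)) /\ v = \sum_i c i *: b i.

(* A vector bundle of rank r: its generic fibre and its stalks, free of rank r
   over the local rings, and almost all spanned by one generic basis. *)
Record bundle (r : nat) := Bundle {
  generic_fiber :> lmodType X;
  stalk : closed_point -> {pred generic_fiber};
  stalk_free : forall p, exists b : 'I_r -> generic_fiber,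
    is_basis b /\ (forall v, v \in stalk p <-> lattice b p v);
  stalk_coherent : exists b : 'I_r -> generic_fiber, is_basis b /\
    finite_set
      [set p | ~ (forall v, v \in stalk p <-> lattice b p v)]%classic }.

Arguments stalk {r} E p : rename.

Variables (r : nat) (E : bundle r).

(* ∇ on the generic fibre, with ∇(E_p) in E_p ⊗ Ω^1(D)_p for every p. *)
Record connection := Connection {
  conn_map :> E -> tensor E Om;
  conn_mapD : forall e e', conn_map (e + e') = conn_map e + conn_map e';
  conn_leibniz : forall f e,
    conn_map (f *: e) = f *: conn_map e + e ⊗ kd Om f;
  conn_poles : forall p e, e \in stalk E p ->
    exists s : seq (E * Om),
      (forall q, q \in s -> q.1 \in stalk E p /\ polar_form p q.2) /\
      conn_map e = \sum_(q <- s) q.1 ⊗ q.2 }.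

Section Fiber.
Variables (x : closed_point) (z : X) (hz : ord x z = 1).

Definition ev_commr : commr_rmorph (cst X) z := fun c => mulrC z (cst X c).
(* F[z] -> K *)
Definition evz : {rmorphism {poly F} -> X} := horner_morph ev_commr.

Fact regularD f g : regular x f -> regular x g -> regular x (f + g).
Proof.
rewrite /regular /ord_ge.
have [->|f0] := eqVneq f 0; first by rewrite add0r.
have [->|g0] := eqVneq g 0; first by rewrite addr0 (negbTE f0).
have [//|fg0] := eqVneq (f + g) 0; rewrite /= => hf hg.
apply: (Order.POrderTheory.le_trans _ (ordD x f0 g0 fg0)).
by rewrite Order.TotalTheory.le_min hf hg.
Qed.
Fact regularM f g : regular x f -> regular x g -> regular x (f * g).
Proof.
rewrite /regular /ord_ge.
have [->|f0] := eqVneq f 0; first by rewrite mul0r eqxx.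
have [->|g0] := eqVneq g 0; first by rewrite mulr0 eqxx.
by move=> /= hf hg; rewrite ordM // Num.Theory.addr_ge0 ?orbT.
Qed.
Fact regular_evz p : regular x (evz p).
Proof.
elim/poly_ind: p => [|p c IH]; first by rewrite rmorph0 /regular /ord_ge eqxx.
rewrite rmorphD rmorphM regularD ?regularM //.
  by rewrite /evz /= horner_morphX /regular /ord_ge hz orbT.
by rewrite /evz /= horner_morphC /regular /ord_ge ord_cst orbT.
Qed.

Fact stalk_submod_closed :
  submod_closed ([pred v | v \in stalk E x] : {pred restr E evz}).
Proof.
have [b [_ hb]] := stalk_free E x.
split=> [|p u v]; rewrite !inE.
  apply/hb; exists (fun=> 0); split=> [i|]; first by rewrite /regular /ord_ge eqxx.
  by rewrite big1 // => i _; rewrite scale0r.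
move=> /hb[c [cr ->]] /hb[c' [cr' ->]]; apply/hb.
exists (fun i => evz p * c i + c' i); split=> [i|].
  by rewrite regularD ?regularM ?regular_evz.
under [RHS]eq_bigr do rewrite scalerDl -scalerA.
by rewrite big_split -scaler_sumr.
Qed.
Definition stalkz : submodule (restr E evz) := Submodule stalk_submod_closed.

(* E|_mx = E_x / z^m E_x as a module over F[z] *)
Definition fiber (m : nat) : lmodType {poly F} :=
  subquot stalkz (scaled 'X^m stalkz).

(* Ω^1(D)|_mx is free over O_mx on dz/z^m (m is the multiplicity of x in D), so
   ∇|_mx is written N dz/z^m with N an O_mx-linear endomorphism of E|_mx. *)
Definition induced (nabla : connection) (m : nat)
    (N : linmap (fiber m) (fiber m)) : Prop :=
  forall e e' : E, e \in stalk E x -> e' \in stalk E x ->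
    nabla e = e' ⊗ (z ^- m *: kd Om z) ->
    N (cls stalkz (scaled 'X^m stalkz) e) = cls stalkz (scaled 'X^m stalkz) e'.
End Fiber.
End Geometry.

Section Subquotients.
Variable F : fieldType.

Fact ideal_submod_closed (a : nat) :
  submod_closed [pred p : {poly F}^o | ('X^a %| (p : {poly F}))%R].
Proof.
split=> [|c p q]; rewrite !inE; first exact: dvdp0.
by move=> ap aq; apply: dvdp_add => //; apply: dvdp_mull.
Qed.
Definition ideal (a : nat) : submodule {poly F}^o :=
  Submodule (ideal_submod_closed a).
(* (w^a)/(w^b), and also (z^a)/(z^b) *)
Definition wquot (a b : nat) : lmodType {poly F} := subquot (ideal a) (ideal b).
Definition wcls (a b : nat) (p : {poly F}) : wquot a b :=
  cls (ideal a) (ideal b) p.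
Definition wrep (a b : nat) (q : wquot a b) : {poly F} :=
  @rep _ _ (ideal a) (ideal b) q.
End Subquotients.

(* [E] stands for E|_mx, [nabla] for N where ∇|_mx = N dz/z^m, and [nu k] for
   the coefficient of ν_k with respect to dz/z^m. *)
Section Ramified.
Variables (F : fieldType) (r m : nat) (E : lmodType {poly F}) (nabla : linmap E E).
Variable nu : nat -> {poly F}.

Definition nR : nat := (m * r - r).+1.
Definition zw : {rmorphism {poly F} -> {poly F}} := comp_poly 'X^r.

(* Coefficient of ν(w) + (k/r) dz/z; note dz/z = z^(m-1) dz/z^m. *)
Definition exponent (k : nat) : {poly F} :=
  \sum_(i < r) zw (nu i) * 'X^i + (k%:R / r%:R)%:P * zw 'X^(m.-1).

(* V_0, ..., V_r *)
Definition filtration : Type := 'I_r.+1 -> submodule E.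
Definition fil (V : filtration) (k : nat) : submodule E := V (inord k).

Definition is_filtration (V : filtration) : Prop :=
  [/\ forall v, v \in fil V 0,
      forall k, (k < r)%N -> {subset fil V k.+1 <= fil V k},
      fil V r =i scaled 'X (fil V 0),
      forall k, (k < r)%N -> has_length (subquot (fil V k) (fil V k.+1)) 1
    & forall k, (k < r)%N -> {in fil V k, forall v, nabla v \in fil V k}].

Definition subm_map (V V' : submodule E) (f : E -> E) : subm V -> subm V' :=
  fun v => tosubm V' (f (val v)).

Section Twist.
Variable L : nat -> lmodType {poly F}.

(* (w)/(w^(n+1)) ⊗ L -> L, f ⊗ l |-> f l *)
Definition wmul k : tensor (wquot F 1 nR.+1) (L k) -> L k :=
  tlift (fun f l => wrep f *: l).

Variable psi : forall k, L k.+1 -> tensor (wquot F 1 nR.+1) (L k).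

(* L_k -> ((w)/(w^(n+1)))^{⊗k} ⊗ L_0 = (w^k)/(w^(n+k)) ⊗ L_0, the composite of
   psi_k, ..., psi_1; for k = r - 1 the target is (w^(r-1))/(w^(mr)) ⊗ L_0.
   Here [psi k] is the map usually indexed by k + 1. *)
Fixpoint chain (k : nat) : L k -> tensor (wquot F k (nR + k)) (L 0) :=
  match k with
  | 0 => fun l => wcls 0 (nR + 0) 1 ⊗ l
  | k.+1 => fun l =>
      tlift (fun f l' =>
        tmap (fun g => wcls k.+1 (nR + k.+1) (wrep f * wrep g)) id (chain l'))
        (psi l)
  end.

Definition is_twist (phi : forall k, L k.+1 -> L k) : Prop :=
  forall k, (k.+1 < r)%N ->
    [/\ linear (@psi k), bijective (@psi k) & forall l, wmul (psi l) = phi k l].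
End Twist.

Section Generic.
Variable V : filtration.

(* V_k ⊗_{O_mx} R as an R-module *)
Definition ext (k : nat) : lmodType {poly F} :=
  btensor zw (subm (fil V k)) (wquot F 0 nR).

(* (L_k, π_k, φ_k, φ_r) on a fixed filtration.  [gphi k] is φ_(k+1), and only
   the components with indices 0 <= k <= r - 1 matter. *)
Record generic_data := GenericData {
  gL : nat -> lmodType {poly F};
  gpi : forall k, ext k -> gL k;
  gphi : forall k, gL k.+1 -> gL k;
  gphir : tensor (wquot F r (m * r).+1) (gL 0) -> gL r.-1 }.

Arguments gpi g k t : clear implicits.
Arguments gphi g k l : clear implicits.
Arguments gphir g t : clear implicits.

(* V_k ⊗ R -> V_k' ⊗ R induced by f : V_k -> V_k' *)
Definition ext_map (k k' : nat) (f : E -> E) : ext k -> ext k' :=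
  tmap (@subm_map (fil V k) (fil V k') f) id.

(* π_k restricted to V_k *)
Definition gpi1 (g : generic_data) k (v : subm (fil V k)) : gL g k :=
  gpi g k (btens zw v (wcls 0 nR 1)).

Arguments gpi1 g k v : clear implicits.

Definition is_generic_on (g : generic_data) : Prop :=
  [/\ is_filtration V,
      forall k, (k < r)%N ->
        [/\ linear (gpi g k),
            exists2 u : wquot F 0 nR -> gL g k, linear u & bijective u,
            forall l, exists v, gpi1 g k v = l
          & forall t : ext k,
              gpi g k (ext_map k nabla t) = exponent k *: gpi g k t],
      (forall k, (k.+1 < r)%N ->
        [/\ linear (gphi g k),
            forall l', (exists l, gphi g k l = l') <-> (exists l, l' = 'X *: l :> gL g k)
          & forall t : ext k.+1, gphi g k (gpi g k.+1 t) = gpi g k (ext_map k id t)]),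
      [/\ linear (gphir g),
          forall l', (exists t, gphir g t = l') <-> (exists l, l' = 'X *: l :> gL g r.-1)
        & forall (p : {poly F}) (t : ext 0), 'X %| p ->
            gphir g (wcls r (m * r).+1 (zw p) ⊗ gpi g 0 t) =
            gpi g r.-1 (ext_map r.-1 ( *:%R p) t)]
    & exists2 psi, is_twist psi (gphi g) &
        forall t, chain psi (gphir g t) =
          tmap (fun q => wcls r.-1 (nR + r.-1) (wrep q)) id t].

Definition generic_equiv_on (g g' : generic_data) : Prop :=
  exists sigma : forall k, gL g k -> gL g' k,
    [/\ forall k, (k < r)%N -> linear (sigma k) /\ bijective (sigma k),
        forall k, (k < r)%N -> forall v, sigma k (gpi1 g k v) = gpi1 g' k v,
        forall k, (k.+1 < r)%N -> forall l : gL g k.+1,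
          sigma k (gphi g k l) = gphi g' k (sigma k.+1 l)
      & forall t, sigma r.-1 (gphir g t) = gphir g' (tmap id (sigma 0) t)].
End Generic.

Inductive generic_data_equiv :
    {V : filtration & generic_data V} -> {V : filtration & generic_data V} -> Prop :=
  GenericDataEquiv V (g g' : generic_data V) of generic_equiv_on g g' :
    generic_data_equiv (existT _ V g) (existT _ V g').

Definition is_generic (g : {V : filtration & generic_data V}) : Prop :=
  is_generic_on (projT2 g).
Definition generic_structure : Type := {g | is_generic g}.
Definition generic_structure_equiv (g g' : generic_structure) : Prop :=
  generic_data_equiv (sval g) (sval g').

Section Factorized.
Variable V : filtration.

Definition O_mx : lmodType {poly F} := wquot F 0 m.

Definition Vbar (k : nat) : lmodType {poly F} :=
  subquot (fil V k) (scaled 'X^(m.-1) (fil V k.+1)).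
Definition Vcls k (v : E) : Vbar k :=
  cls (fil V k) (scaled 'X^(m.-1) (fil V k.+1)) v.
Definition iota k : Vbar k.+1 -> Vbar k := fun q =>
  Vcls k (@rep _ _ (fil V k.+1) _ q).
(* (z)/(z^(m+1)) ⊗ Vbar_0 -> Vbar_(r-1) *)
Definition iotar : tensor (wquot F 1 m.+1) (Vbar 0) -> Vbar r.-1 :=
  tlift (fun p q => Vcls r.-1 (wrep p *: @rep _ _ (fil V 0) _ q)).

(* Vdual j is W_k for k = r - 1 - j. *)
Definition Vdual (j : nat) : lmodType {poly F} := linmap (Vbar j) O_mx.
Definition iotaW j : Vdual j -> Vdual j.+1 :=
  fun xi => homof (fun v => xi (iota v)).
Definition iotarW : tensor (wquot F 1 m.+1) (Vdual r.-1) -> Vdual 0 :=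
  tlift (fun p (xi : Vdual r.-1) => homof (fun v => xi (iotar (p ⊗ v))) : Vdual 0).

(* For k + j + 1 = r, [vartheta k j] is the pairing ϑ_k on W_k x W_(r-k-1) =
   Vdual j x Vdual k and [varkappa k j] is ϰ_k on Vbar_k x Vbar_(r-k-1), in
   curried form (so varkappa k j is also the induced map κ_k to W_k); the
   components with other indices are irrelevant. *)
Record factorized_data := FactorizedData {
  vartheta : forall k j, linmap (Vdual j) (linmap (Vdual k) O_mx);
  varkappa : forall k j, linmap (Vbar k) (Vdual j) }.

(* θ_k : W_k -> Hom(W_(r-k-1), O_mx) = Vbar_k, the latter by evaluation. *)
Definition theta (s : factorized_data) k j : linmap (Vdual j) (Vbar k) :=
  homof (fun xi =>
    xget 0 [set v | forall eta : Vdual k, vartheta s k j xi eta = eta v]%classic).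
Definition Nop (s : factorized_data) k : linmap (Vbar k) (Vbar k) :=
  homcomp (theta s k (r - k.+1)) (varkappa s k (r - k.+1)).
Definition wVbar (s : factorized_data) (k : nat) : lmodType {poly F} :=
  polymod (Nop s k).
Definition trN (s : factorized_data) j (xi : Vdual j) : Vdual j :=
  homcomp xi (Nop s j).

Definition is_factorized_on (s : factorized_data) : Prop :=
  [/\ is_filtration V,
      [/\ forall k j, (k + j).+1 = r -> forall v v',
            vartheta s k j v v' = vartheta s j k v' v,
          forall k j, (k + j).+1 = r -> bijective (theta s k j),
          forall k j, (k + j).+2 = r -> forall xi,
            theta s k j.+1 (iotaW xi) = iota (theta s k.+1 j xi)
        & forall t, theta s r.-1 0 (iotarW t) =
            iotar (tmap id (theta s 0 r.-1) t)],
      [/\ forall k j, (k + j).+1 = r -> forall v v',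
            varkappa s k j v v' = varkappa s j k v' v,
          forall k j, (k + j).+2 = r -> forall v,
            varkappa s k j.+1 (iota v) = iotaW (varkappa s k.+1 j v)
        & forall t, varkappa s r.-1 0 (iotar t) =
            iotarW (tmap id (varkappa s 0 r.-1) t)],
      forall k, (k < r)%N ->
        [/\ forall v, iter r (Nop s k) v = 'X *: v,
            forall v, iter nR (Nop s k) v = 0,
            forall f, (forall v, polyact (Nop s k) f v = 0) -> 'X^nR %| f
          & {in fil V k, forall v,
              Vcls k (nabla v) = polyact (Nop s k) (exponent k) (Vcls k v)}]
    & exists2 psi, @is_twist (wVbar s) psi iota &
        forall (p : {poly F}) (v : Vbar 0), 'X %| p ->
          chain psi (iotar (wcls 1 m.+1 p ⊗ v) : wVbar s r.-1) =
          wcls r.-1 (nR + r.-1) (zw p) ⊗ (v : wVbar s 0)].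

(* [vs j] is ς_k for k = r - 1 - j. *)
Definition factorized_equiv_on (s s' : factorized_data) : Prop :=
  (forall k, (k < r)%N -> Nop s k =1 Nop s' k) /\
  exists vs : forall j, linmap (Vdual j) (Vdual j),
    [/\ forall j, (j < r)%N ->
          bijective (vs j) /\ (forall xi, trN s (vs j xi) = vs j (trN s xi)),
        forall k j, (k + j).+1 = r ->
          (forall xi, theta s' k j xi = theta s k j (vs j xi)) /\
          (forall v, vs j (varkappa s' k j v) = varkappa s k j v),
        forall j, (j.+1 < r)%N -> forall xi, iotaW (vs j xi) = vs j.+1 (iotaW xi)
      & forall t, vs 0 (iotarW t) = iotarW (tmap id (vs r.-1) t)].

(* π_k(v ⊗ f) = f(N_k) [v]; an element w^r g ⊗ v of (w^r)/(w^(mr+1)) ⊗ Vbar_0 is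
   z ⊗ g(N_0) v in (z)/(z^(m+1)) ⊗ Vbar_0. *)
Definition correspondence_on (s : factorized_data) : generic_data V :=
  @GenericData V (wVbar s)
    (fun k => tlift (fun (v : subm (fil V k)) (f : restr (wquot F 0 nR) zw) =>
       polyact (Nop s k) (wrep f) (Vcls k (val v))))
    iota
    (tlift (fun (q : wquot F r (m * r).+1) (v : wVbar s 0) =>
       iotar (wcls 1 m.+1 'X ⊗ polyact (Nop s 0) (wrep q %/ 'X^r) v)
         : wVbar s r.-1)).
End Factorized.

Inductive factorized_data_equiv :
    {V : filtration & factorized_data V} ->
    {V : filtration & factorized_data V} -> Prop :=
  FactorizedDataEquiv V (s s' : factorized_data V) of factorized_equiv_on s s' :
    factorized_data_equiv (existT _ V s) (existT _ V s').

Definition is_factorized (s : {V : filtration & factorized_data V}) : Prop :=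
  is_factorized_on (projT2 s).
Definition factorized_structure : Type := {s | is_factorized s}.
Definition factorized_structure_equiv (s s' : factorized_structure) : Prop :=
  factorized_data_equiv (sval s) (sval s').

Definition correspondence (s : {V : filtration & factorized_data V}) :
    {V : filtration & generic_data V} :=
  existT _ (projT1 s) (correspondence_on (projT2 s)).
End Ramified.

(* The set of equivalence classes, and the class of an element. *)
Definition classes (T : Type) (e : T -> T -> Prop) : Type :=
  {S : T -> Prop | exists a, S = e a}.
Definition class_of (T : Type) (e : T -> T -> Prop) (a : T) : classes e :=
  exist _ (e a) (ex_intro _ a erefl).

Arguments correspondence {F} r m {E} s.
Arguments is_factorized {F} r m {E} nabla nu s.
Arguments is_generic {F} r m {E} nabla nu g.
Arguments factorized_structure {F} r m {E} nabla nu.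
Arguments generic_structure {F} r m {E} nabla nu.
Arguments factorized_structure_equiv {F} r m {E} nabla nu s s'.
Arguments generic_structure_equiv {F} r m {E} nabla nu g g'.
Arguments class_of {T} e a.

(* Main.v *)
(* Put n = mr - r + 1.  The isomorphisms psi_k of either kind of structure propagate a
   generator of L_0 (resp. Vbar_0) to generators u_k of all L_k (resp. Vbar_k) such that
   the canonical maps send u_k to w u_(k-1) and z ⊗ u_0 to w u_(r-1); so every module is
   F[w]/(w^n) and every canonical map is multiplication by w.  For a generic structure,
   V_k -> L_k identifies Vbar_k with L_k: it maps the successive steps of the filtration
   V_k, V_(k+1), ..., V_r = z V_0, z V_1, ... to the powers of w, and the n-th step is
   z^(m-1) V_(k+1).  As n - 1 = r (m - 1), the pairing (f, g) |-> tr(f g), where tr is the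
   projection of F[w] onto F[z], makes F[w]/(w^n) self-dual over F[z]/(z^m); hence W_k is
   again F[w]/(w^n), and theta = 1, kappa = w is a factorized structure with N_k = w.
   Conversely the class of a factorized structure is determined by the V_k and N_k:
   if N'_k = N_k, then theta_k^-1 theta'_k is an equivalence, as it commutes with the
   transposes of the N_k by the symmetry of the pairings. *)

Require Import Defs.
From mathcomp Require Import all_boot all_order all_algebra.
From mathcomp Require Import boolp classical_sets ring.
From mathcomp Require Import reals complex.
Set Implicit Arguments.
Unset Strict Implicit.
Unset Printing Implicit Defensive.
Import GRing.Theory.
Local Open Scope ring_scope.

(** * Subquotients and tensor products *)

(** The twists are given only as isomorphisms, and conditions such as the one on their composite are
    awkward to check on representatives of tensors. Once a generator is fixed, [tcoord] reads every
    tensor product (w^a)/(w^(n+a)) ⊗ L injectively in F[w]/(w^n), so that each axiom becomes an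
    identity between multiplications in this ring. The ground ring needs care: L_k is an F[w]-module
    from the start, while Vbar_k is only an F[z]-module until N_k is built, so its coordinates are
    merely semilinear along z |-> w^r ([zcoord]). Injectivity on classes rests on the surjection V_k
    -> Vbar_k being part of the data: an equivalence between two images must be the identity on
    Vbar_k, and its F[w]-linearity forces N_k = N'_k. Surjectivity rests on V_(k+1) being the full
    preimage of w L_k in V_k: if a nonzero element of the line V_k/V_(k+1) landed in w L_k, so would
    all of V_k, although V_k -> L_k is onto. *)

Lemma subm_valP (A : comNzRingType) (M : lmodType A) (V : submodule M) a (x y : subm V) :
  val (a *: x + y) = a *: val x + val y.
Proof. by rewrite GRing.valD GRing.valZ. Qed.

Section Subquotients.
Variables (A : comNzRingType) (M : lmodType A) (V S : submodule M).

Lemma val_tosubm x : x \in V -> val (tosubm V x) = x.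
Proof. by move=> xV; rewrite /tosubm insubdK. Qed.

Lemma cls_eq x y : x \in V -> y \in V -> cls V S x = cls V S y <-> x - y \in S.
Proof.
move=> xV yV; rewrite /cls -{2}(val_tosubm xV) -{2}(val_tosubm yV).
by rewrite -subquot_pi_eq; split=> [->|/eqP].
Qed.

Lemma rep_in (q : subquot V S) : rep q \in V.
Proof. exact: valP. Qed.

Lemma repK (q : subquot V S) : cls V S (rep q) = q.
Proof. by rewrite /cls /tosubm valKd subquot_reprK. Qed.

Lemma rep_cls x : x \in V -> rep (cls V S x) - x \in S.
Proof. by move=> xV; apply/cls_eq; rewrite ?rep_in ?repK. Qed.

Lemma clsP a x y : x \in V -> y \in V ->
  cls V S (a *: x + y) = a *: cls V S x + cls V S y.
Proof.
move=> xV yV; rewrite /cls [a *: subquot_pi _ _]subquot_scaleE -subquot_piD.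
congr subquot_pi; apply: val_inj.
by rewrite GRing.valD GRing.valZ !val_tosubm // rpredD ?rpredZ.
Qed.

Lemma cls0 : cls V S 0 = 0.
Proof. by have := clsP (-1) (rpred0 V) (rpred0 V); rewrite scaler0 addr0 scaleN1r addNr. Qed.

Lemma cls_eq0 x : x \in V -> cls V S x = 0 <-> x \in S.
Proof. by move=> xV; rewrite -cls0 cls_eq ?rpred0 // subr0. Qed.

Lemma clsZ a x : x \in V -> cls V S (a *: x) = a *: cls V S x.
Proof. by move=> xV; rewrite -[a *: x]addr0 clsP ?rpred0 // cls0 addr0. Qed.

Lemma clsD x y : x \in V -> y \in V -> cls V S (x + y) = cls V S x + cls V S y.
Proof. by move=> xV yV; have := clsP 1 xV yV; rewrite !scale1r. Qed.
End Subquotients.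

Section PolyQuotients.
Variables (F : fieldType) (a b : nat).
Implicit Types p q : {poly F}.

Lemma wcls_eq p q : 'X^a %| p -> 'X^a %| q ->
  wcls a b p = wcls a b q <-> 'X^b %| p - q.
Proof. by move=> ap aq; apply: cls_eq. Qed.

Lemma wcls_eq0 p : 'X^a %| p -> wcls a b p = 0 <-> 'X^b %| p.
Proof. by move=> ap; apply: cls_eq0. Qed.

Lemma wrep_dvd (q : wquot F a b) : 'X^a %| wrep q.
Proof. exact: (rep_in q). Qed.

Lemma wrepK (q : wquot F a b) : wcls a b (wrep q) = q.
Proof. exact: repK. Qed.

Lemma wrep_wcls p : 'X^a %| p -> 'X^b %| wrep (wcls a b p) - p.
Proof. by move=> ap; apply/wcls_eq; rewrite ?wrep_dvd ?wrepK. Qed.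

Lemma wclsP c p q : 'X^a %| p -> 'X^a %| q ->
  wcls a b (c * p + q) = c *: wcls a b p + wcls a b q.
Proof. by move=> ap aq; apply: clsP. Qed.

Lemma wclsZ c p : 'X^a %| p -> wcls a b (c * p) = c *: wcls a b p.
Proof. by move=> ap; apply: clsZ. Qed.

Lemma wclsD p q : 'X^a %| p -> 'X^a %| q ->
  wcls a b (p + q) = wcls a b p + wcls a b q.
Proof. by move=> ap aq; apply: clsD. Qed.

Lemma wrepP c (p q : wquot F a b) : 'X^b %| wrep (c *: p + q) - (c * wrep p + wrep q).
Proof.
have h : 'X^a %| c * wrep p + wrep q by rewrite dvdp_add ?dvdp_mull ?wrep_dvd.
by apply/wcls_eq; rewrite ?wrep_dvd // wclsP ?wrep_dvd // !wrepK.
Qed.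

Lemma wrepZ c (p : wquot F a b) : 'X^b %| wrep (c *: p) - c * wrep p.
Proof. by apply/wcls_eq; rewrite ?dvdp_mull ?wrep_dvd // wclsZ ?wrep_dvd // !wrepK. Qed.

Lemma dvd_wrepB (p : wquot F a b) q : 'X^a %| q -> p = wcls a b q -> 'X^b %| wrep p - q.
Proof. by move=> aq ->; apply: wrep_wcls. Qed.

Lemma dvd_wrep0 : 'X^b %| wrep (0 : wquot F a b).
Proof.
by have := dvd_wrepB (dvdp0 _) (esym (cls0 _ _) : 0 = wcls a b 0); rewrite subr0.
Qed.
End PolyQuotients.

(** Covers the canonical map (z)/(w^(mr+1)) -> (w^(r-1))/(w^(mr)) in the condition on the composite
    of the twists. *)
Lemma wquot_sub_linear (F : fieldType) a b a' b' : (a' <= a)%N -> (b' <= b)%N ->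
  linear (fun q : wquot F a b => wcls a' b' (wrep q)).
Proof.
move=> aa bb; have Xa (q : wquot F a b) : 'X^a' %| wrep q.
  by apply: dvdp_trans (wrep_dvd q); rewrite dvdp_exp2l.
move=> p q q'; rewrite -wclsP //; apply/wcls_eq => //.
  by rewrite dvdp_add ?dvdp_mull.
by apply: dvdp_trans (wrepP p q q'); rewrite dvdp_exp2l.
Qed.

Section Tensors.
Variables (A : comNzRingType).
Implicit Types M N P : lmodType A.

Lemma tens_ind M N (Pr : tensor M N -> Prop) :
  Pr 0 -> (forall s t, Pr s -> Pr t -> Pr (s + t)) -> (forall m n, Pr (m ⊗ n)) ->
  forall t, Pr t.
Proof. by move=> P0 PD Pt t; rewrite [t]tensor_sum; elim/big_ind: _. Qed.

Lemma tens_linl M N a (m m' : M) (n : N) : (a *: m + m') ⊗ n = a *: (m ⊗ n) + m' ⊗ n.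
Proof. exact: (tens_bilinear _ _).1. Qed.

Lemma tens_linr M N a (m : M) (n n' : N) : m ⊗ (a *: n + n') = a *: (m ⊗ n) + m ⊗ n'.
Proof. exact: (tens_bilinear _ _).2. Qed.

Lemma tens0 M N (m : M) : m ⊗ 0 = 0 :> tensor M N.
Proof. by have := tens_linr (-1) m 0 (0 : N); rewrite scaler0 addr0 scaleN1r addNr. Qed.

Lemma tensZr M N a (m : M) (n : N) : m ⊗ (a *: n) = a *: (m ⊗ n).
Proof. by rewrite -[a *: n]addr0 tens_linr tens0 addr0. Qed.

Lemma tens0l M N (n : N) : 0 ⊗ n = 0 :> tensor M N.
Proof. by have := tens_linl (-1) 0 (0 : M) n; rewrite scaler0 addr0 scaleN1r addNr. Qed.

Lemma tensZl M N a (m : M) (n : N) : (a *: m) ⊗ n = a *: (m ⊗ n).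
Proof. by rewrite -[a *: m]addr0 tens_linl tens0l addr0. Qed.

Lemma tensDr M N (m : M) (n n' : N) : m ⊗ (n + n') = m ⊗ n + m ⊗ n'.
Proof. by rewrite -{1}[n]scale1r tens_linr scale1r. Qed.

Lemma linear_map0 M N (f : M -> N) : linear f -> f 0 = 0.
Proof. by move=> fP; apply: (linear0 (Linmap fP)). Qed.

Lemma linear_mapD M N (f : M -> N) : linear f -> {morph f : x y / x + y}.
Proof. by move=> fP; apply: (linearD (Linmap fP)). Qed.

Lemma linear_mapZ M N (f : M -> N) : linear f -> forall a, {morph f : x / a *: x}.
Proof. by move=> fP a x; apply: (linearZ_LR (Linmap fP)). Qed.

Lemma semilinear0 (B : comNzRingType) (h : {rmorphism A -> B}) M (N : lmodType B)
    (f : M -> N) : (forall a x y, f (a *: x + y) = h a *: f x + f y) -> f 0 = 0.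
Proof.
by move=> fL; have := fL (-1) 0 0; rewrite scaler0 addr0 rmorphN1 scaleN1r addNr.
Qed.

Lemma tensor_linear_ext M N P (f g : tensor M N -> P) : linear f -> linear g ->
  (forall m n, f (m ⊗ n) = g (m ⊗ n)) -> f =1 g.
Proof.
move=> fP gP fg; elim/tens_ind=> [|s t fs ft|//]; first by rewrite !linear_map0.
by rewrite !linear_mapD // fs ft.
Qed.

Lemma tmap_bilinear M N M' N' (f : M -> M') (g : N -> N') :
  linear f -> linear g -> bilinear_map (fun m n => f m ⊗ g n).
Proof. by move=> fP gP; split=> [n|m] a x y; rewrite ?fP ?gP ?tens_linl ?tens_linr. Qed.

Lemma tmapE M N M' N' (f : M -> M') (g : N -> N') m n :
  linear f -> linear g -> tmap f g (m ⊗ n) = f m ⊗ g n.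
Proof. by move=> fP gP; rewrite /tmap tliftE //; apply: tmap_bilinear. Qed.

Lemma tmap_linear M N M' N' (f : M -> M') (g : N -> N') :
  linear f -> linear g -> linear (tmap f g).
Proof. by move=> fP gP; apply/tlift_linear/tmap_bilinear. Qed.

Lemma id_linear M : linear (@id M).
Proof. by []. Qed.

Lemma comp_linear M N P (f : N -> P) (g : M -> N) : linear f -> linear g -> linear (f \o g).
Proof. by move=> fP gP a x y; rewrite /= gP fP. Qed.

Lemma homofE M N (f : M -> N) : linear f -> homof f = f :> (M -> N).
Proof. by rewrite /homof => fP; case: pselect. Qed.
End Tensors.

(** * Twists and coordinates *)

Section Congruences.
Variable F : fieldType.
Implicit Types p q : {poly F}.

Lemma dvdXnP k p : reflect (forall i, (i < k)%N -> p`_i = 0) ('X^k %| p).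
Proof.
apply: (iffP idP) => [/dvdpP[q ->] i ik|h]; first by rewrite coefMXn ik.
rewrite -[p](poly_take_drop k) dvdp_addl ?dvdp_mull //.
suff -> : take_poly k p = 0 by apply: dvdp0.
by apply/polyP => i; rewrite coef_take_poly coef0; case: ltnP => // /h.
Qed.

Lemma wquot_ann a b (q : wquot F a b) p : 'X^b %| p * wrep q -> p *: q = 0.
Proof.
move=> h; rewrite -[q]wrepK -wclsZ ?wrep_dvd //.
exact/(wcls_eq0 b (dvdp_mull p (wrep_dvd q))).
Qed.

Lemma wquot_scale_eq n (q : wquot F 0 n) p p' : 'X^n %| p - p' -> p *: q = p' *: q.
Proof.
by move=> h; apply/eqP; rewrite -subr_eq0 -scalerBl; apply/eqP/wquot_ann/dvdp_mulr.
Qed.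

Lemma wrep_dvdX b (q : wquot F 1 b) : 'X %| wrep q.
Proof. exact: (wrep_dvd q). Qed.

Lemma dvd_divXn a n p q : 'X^a %| p -> 'X^a %| q ->
  'X^(n + a) %| p - q -> 'X^n %| p %/ 'X^a - q %/ 'X^a.
Proof.
move=> pa qa; rewrite -{1}(divpK pa) -{1}(divpK qa) -mulrBl exprD dvdp_mul2r //.
by rewrite -size_poly_eq0 size_polyXn.
Qed.
End Congruences.

Section TensorCoordinates.
Variables (F : fieldType) (n a b : nat) (hb : b = (n + a)%N).
Variables (L : lmodType {poly F}) (c : L -> wquot F 0 n).
Hypotheses (cL : linear c) (cB : bijective c).

(* w^a f ⊗ l |-> f c(l) *)
Definition tcoord : tensor (wquot F a b) L -> wquot F 0 n :=
  tlift (fun q l => (wrep q %/ 'X^a) *: c l).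

(** Since b = n + a, the ambiguity w^b of a representative becomes w^n after division by w^a, and
    w^n kills every coordinate; this makes [tcoord] well defined. *)
Lemma divXn_wrepP p (q q' : wquot F a b) :
  'X^n %| wrep (p *: q + q') %/ 'X^a - (p * (wrep q %/ 'X^a) + wrep q' %/ 'X^a).
Proof.
rewrite divp_mulA ?wrep_dvd // -divpD.
apply: dvd_divXn; [exact: wrep_dvd | by rewrite dvdp_add ?dvdp_mull ?wrep_dvd |].
by rewrite -hb wrepP.
Qed.

Lemma tcoord_bilinear :
  bilinear_map (fun (q : wquot F a b) l => (wrep q %/ 'X^a) *: c l).
Proof.
split=> [l p q q'|q p l l'].
  by rewrite (wquot_scale_eq _ (divXn_wrepP p q q')) scalerDl scalerA.
by rewrite cL scalerDr !scalerA mulrC.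
Qed.

Lemma tcoord_linear : linear tcoord.
Proof. exact/tlift_linear/tcoord_bilinear. Qed.

Lemma tcoordE q l : tcoord (q ⊗ l) = (wrep q %/ 'X^a) *: c l.
Proof. exact/tliftE/tcoord_bilinear. Qed.

Lemma tcoord_wcls p l : tcoord (wcls a b (p * 'X^a) ⊗ l) = p *: c l.
Proof.
rewrite tcoordE; apply: wquot_scale_eq.
rewrite -{2}[p](@mulpK _ _ 'X^a) -?size_poly_eq0 ?size_polyXn //.
apply: dvd_divXn; [exact: wrep_dvd | exact: dvdp_mull |].
by rewrite -hb wrep_wcls ?dvdp_mull.
Qed.

Lemma wclsE_div (q : wquot F a b) :
  q = (wrep q %/ 'X^a) *: wcls a b 'X^a.
Proof. by rewrite -wclsZ // divpK ?wrep_dvd ?wrepK. Qed.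

(** [tlift B] is the induced map only once [B] is bilinear. For the map φ_r of the correspondence,
    written with representatives, bilinearity is read off its coordinate formula, [c'] being
    injective. *)
Lemma bilinear_of_coord (L' : lmodType {poly F}) (c' : L' -> wquot F 0 n)
    (B : wquot F a b -> L -> L') : linear c' -> bijective c' ->
  (forall q l, c' (B q l) = 'X *: ((wrep q %/ 'X^a) *: c l)) -> bilinear_map B.
Proof.
move=> c'L c'B BE; split=> [l p q q'|q p l l']; apply: (bij_inj c'B);
  rewrite c'L !BE ?tcoord_bilinear.1 ?tcoord_bilinear.2 scalerDr !scalerA;
  by rewrite (mulrC 'X p).
Qed.

Lemma coord_tlift (L' : lmodType {poly F}) (c' : L' -> wquot F 0 n)
    (B : wquot F a b -> L -> L') : linear c' -> bijective c' ->
  (forall q l, c' (B q l) = 'X *: ((wrep q %/ 'X^a) *: c l)) ->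
  forall t, c' (tlift B t) = 'X *: tcoord t.
Proof.
move=> c'L c'B BE; have BL := bilinear_of_coord c'L c'B BE.
apply: tensor_linear_ext.
- exact: comp_linear c'L (tlift_linear BL).
- by move=> p s t; rewrite tcoord_linear scalerDr !scalerA mulrC.
by move=> q l; rewrite tliftE // tcoordE BE.
Qed.

Lemma tcoord_bij : bijective tcoord.
Proof.
have [d cd dc] := cB.
have dL : linear d by move=> p x y; apply: (bij_inj cB); rewrite cL !dc.
exists (fun x => wcls a b 'X^a ⊗ d x) => [|x]; last first.
  by rewrite -['X^a]mul1r tcoord_wcls scale1r dc.
apply: (@tensor_linear_ext _ _ _ _ (fun t => wcls a b 'X^a ⊗ d (tcoord t)) id) => //.
  by move=> p t t'; rewrite tcoord_linear dL tens_linr.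
by move=> q l; rewrite tcoordE linear_mapZ // cd tensZr -tensZl -wclsE_div.
Qed.
End TensorCoordinates.

Section Twists.
Variables (F : fieldType) (r m : nat) (L : nat -> lmodType {poly F}).
Let n := nR r m.
Variable psi : forall k, L k.+1 -> tensor (wquot F 1 n.+1) (L k).

Let n1 : n.+1 = (n + 1)%N. Proof. by rewrite addn1. Qed.

Definition coordinates (c : forall k, L k -> wquot F 0 n) : Prop :=
  forall k, (k < r)%N -> linear (@c k) /\ bijective (@c k).

Variable c : forall k, L k -> wquot F 0 n.

Lemma wmul_bilinear :
  bilinear_map (fun (f : wquot F 1 n.+1) (l : wquot F 0 n) => wrep f *: l).
Proof.
split=> [l p q q'|q p l l']; last by rewrite scalerDr !scalerA mulrC.
rewrite scalerA -scalerDl; apply: wquot_scale_eq.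
by apply: dvdp_trans (wrepP p q q'); rewrite dvdp_exp2l.
Qed.

(** The factor w appears because [tcoord] divides the first component by w and [wmul] does not. *)
Lemma coord_wmul k : linear (@c k) -> bijective (@c k) ->
  forall t, @c k (@wmul F r m L k t) = 'X *: tcoord (@c k) t.
Proof.
move=> cL cB; have ci := bij_inj cB.
have blin : bilinear_map (fun (f : wquot F 1 n.+1) (l : L k) => wrep f *: l).
  by split=> [l p q q'|q p l l']; apply: ci; rewrite !(cL, linear_mapZ cL);
    [apply: wmul_bilinear.1 | apply: wmul_bilinear.2].
apply: tensor_linear_ext.
- exact: comp_linear cL (tlift_linear blin).
- by move=> p s t; rewrite (tcoord_linear n1 cL) scalerDr !scalerA mulrC.
move=> q l; rewrite tcoordE // /wmul tliftE // linear_mapZ // scalerA.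
by rewrite mulrC divpK // wrep_dvdX.
Qed.

Hypothesis cpsi : forall k, (k.+1 < r)%N -> forall l, @c k.+1 l = tcoord (@c k) (@psi k l).
Hypothesis c0L : linear (@c 0).

(** By [cpsi] each twist is the identity in coordinates, hence so is the composite: dividing f g by
    w^(k+1) amounts to dividing f by w and g by w^k. *)
Lemma coord_chain k : (k < r)%N -> (forall j, (j <= k)%N -> linear (@c j)) ->
  (forall j, (j < k)%N -> linear (@psi j)) ->
  linear (chain psi (k := k)) /\
  forall l, tcoord (@c 0) (chain psi l) = @c k l.
Proof.
elim: k => [|k IH] kr cL psiL.
  split=> [p l l'|l] /=; first by rewrite tens_linr.
  have := @tcoord_wcls F n 0 _ erefl _ _ c0L 1 l.
  by rewrite expr0 mulr1 scale1r.
have [|j jk|j jk|chL chE] := IH; [exact: ltnW|exact/cL/leqW|exact/psiL/leqW|].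
have nk : (n + k.+1)%N = (n + k.+1)%N by [].
pose mu (f : wquot F 1 n.+1) (g : wquot F k (n + k)) :=
  wcls k.+1 (n + k.+1) (wrep f * wrep g).
have ckL : linear (@c k) by apply: cL; apply: leqnSn.
have dvdfg (f : wquot F 1 n.+1) (g : wquot F k (n + k)) : 'X^(k.+1) %| wrep f * wrep g.
  by rewrite exprS dvdp_mul ?wrep_dvd ?wrep_dvdX.
(* Changing f by a multiple of w^(n+1), or g by a multiple of w^(n+k), changes f g by a multiple of
   w^(n+k+1), because w^k divides g and w divides f. *)
have muL : bilinear_map mu.
  have dvdD p (f f' : wquot F 1 n.+1) (g g' : wquot F k (n + k)) :
      'X^(k.+1) %| p * (wrep f * wrep g) + wrep f' * wrep g'.
    by apply: dvdp_add; [apply: dvdp_mull|]; apply: dvdfg.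
  split=> [g p f f'|f p g g']; rewrite /mu -wclsP ?dvdfg //;
    apply/(wcls_eq _ (dvdfg _ _) (dvdD _ _ _ _ _)).
  - by rewrite mulrA -mulrDl -mulrBl addnS -addSn exprD dvdp_mul ?wrep_dvd ?wrepP.
  - by rewrite mulrCA -mulrDr -mulrBr addnS exprS dvdp_mul ?wrepP ?wrep_dvdX.
have tL (f : wquot F 1 n.+1) : linear (tmap (mu f) (@id (L 0))).
  by apply: tmap_linear => //; apply: muL.2.
have bl : bilinear_map (fun (f : wquot F 1 n.+1) (l' : L k) =>
    tmap (mu f) id (chain psi l')).
  split=> [l p f f'|f p l l']; last by rewrite chL tL.
  move: (chain psi l); apply: (@tensor_linear_ext _ _ _ _ _
    (fun t => p *: tmap (mu f) id t + tmap (mu f') id t)) => //.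
    by move=> q s t; rewrite !tL !scalerDr !scalerA mulrC addrACA.
  by move=> g l0; rewrite !tmapE ?muL.1 ?tens_linl //; exact: muL.2.
split=> [p l l'|l] /=.
  by rewrite psiL // (tlift_linear bl).
rewrite cpsi //; move: (@psi k l) => {l}.
apply: tensor_linear_ext.
- exact: comp_linear (tcoord_linear nk c0L) (tlift_linear bl).
- refine (tcoord_linear n1 ckL).
move=> f l; rewrite (tcoordE n1 ckL).
rewrite tliftE // -chE; move: (chain psi l) => {l}.
apply: tensor_linear_ext.
- exact: comp_linear (tcoord_linear nk c0L) (tL f).
- by move=> p s t; rewrite (tcoord_linear _ c0L) // scalerDr !scalerA mulrC.
move=> g l; rewrite tmapE //; last exact: muL.2.
have fgE : wrep f * wrep g = (wrep f %/ 'X^1 * (wrep g %/ 'X^k)) * 'X^(k.+1).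
  by rewrite -{1}(divpK (wrep_dvd f)) -{1}(divpK (wrep_dvd g)) mulrACA -exprD.
by rewrite /mu fgE tcoord_wcls // tcoordE // scalerA.
Qed.
End Twists.

Section Frames.
Variables (F : fieldType) (r m : nat) (L : nat -> lmodType {poly F}).
Variables (phi : forall k, L k.+1 -> L k) (phir : L 0 -> L r.-1).
Let n := nR r m.

(* This is what the twists psi_k amount to once a generator of L_0 is chosen: the
   canonical maps all become multiplication by w on F[w]/(w^n). *)
Definition frame (c : forall k, L k -> wquot F 0 n) : Prop :=
  [/\ @coordinates F r m L c,
      forall k, (k.+1 < r)%N -> forall l, c k (phi l) = 'X *: c k.+1 l
    & forall l, c r.-1 (phir l) = 'X *: c 0 l].

Let n1 : n.+1 = (n + 1)%N. Proof. by rewrite addn1. Qed.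

Fixpoint twist_coord (psi : forall k, L k.+1 -> tensor (wquot F 1 n.+1) (L k))
    (c0 : L 0 -> wquot F 0 n) (k : nat) : L k -> wquot F 0 n :=
  match k with
  | 0 => c0
  | k.+1 => fun l => tcoord (@twist_coord psi c0 k) (@psi k l)
  end.

(** Coordinates are carried from L_0 to L_k through the twists. The condition on the composite
    places the image of l at w^r ⊗ l inside (w^(r-1))/(w^(mr)) ⊗ L_0, and dividing by w^(r-1) leaves
    exactly one w: thus [phir] is also multiplication by w. *)
Lemma twist_frame (psi : forall k, L k.+1 -> tensor (wquot F 1 n.+1) (L k))
    (c0 : L 0 -> wquot F 0 n) :
  (0 < r)%N -> linear c0 -> bijective c0 -> @is_twist F r m L psi phi ->
  (forall l, chain psi (phir l) = wcls r.-1 (n + r.-1) 'X^r ⊗ l) ->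
  exists2 c, frame c & forall l, tcoord (c 0) (chain psi l) = c r.-1 l.
Proof.
move=> r0 c0L c0B psiP chE; pose c := @twist_coord psi c0.
have cP : @coordinates F r m L c.
  elim=> [|k IH] kr //; have [cL cB] := IH (ltnW kr); have [pL pB _] := psiP k kr.
  split; last exact: (bij_comp (tcoord_bij n1 cL cB) pB).
  refine (comp_linear (tcoord_linear n1 cL) pL).
have jr j : (j <= r.-1)%N -> (j < r)%N by rewrite -ltnS prednK.
have cpsi k : (k.+1 < r)%N -> forall l', c k.+1 l' = tcoord (c k) (@psi k l') by [].
have cL j : (j <= r.-1)%N -> linear (c j) by move=> /jr /cP[].
have pL j : (j < r.-1)%N -> linear (@psi j) by move=> /jr /psiP[].
have [_ cchain] := coord_chain cpsi c0L (jr _ (leqnn _)) cL pL.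
exists c => //; split=> // [k kr l|l].
  have [ckL ckB] := cP k (ltnW kr); have [_ _ <-] := psiP k kr.
  exact: (coord_wmul ckL ckB).
rewrite -cchain chE.
have -> : 'X^r = 'X * 'X^(r.-1) :> {poly F} by rewrite -exprS prednK.
by rewrite tcoord_wcls.
Qed.

Lemma frame_image c k : frame c -> (k.+1 < r)%N ->
  forall l', (exists l, phi l = l') <-> exists l, l' = 'X *: l :> L k.
Proof.
move=> [cP cphi _] kr l'; have [cL cB] := cP k (ltnW kr).
have [c'L c'B] := cP k.+1 kr.
have [d cd dc] := cB; have [d' cd' dc'] := c'B.
split=> [[l <-]|[l ->]].
  by exists (d (c k.+1 l)); apply: (bij_inj cB); rewrite cphi // linear_mapZ // dc.
by exists (d' (c k l)); apply: (bij_inj cB); rewrite cphi // linear_mapZ // dc'.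
Qed.

(** Converse of [twist_frame], by which the model acquires its twists: psi_k is [c k.+1] followed by
    the inverse of [tcoord (c k)]. As that map is onto, the default of [xget] is never taken when k
    + 1 < r. *)
Lemma frame_twist c : frame c ->
  exists2 psi, @is_twist F r m L psi phi & forall k, (k < r)%N ->
    linear (@chain F r m L psi k) /\
    forall l, tcoord (c 0) (chain psi l) = c k l.
Proof.
move=> [cP cphi cphir].
pose psi k (l : L k.+1) : tensor (wquot F 1 n.+1) (L k) :=
  xget 0 [set t | tcoord (c k) t = c k.+1 l]%classic.
have psiE k : (k.+1 < r)%N -> forall l, c k.+1 l = tcoord (c k) (@psi k l).
  move=> kr l; have [cL cB] := cP k (ltnW kr).
  have [d _ dc] := tcoord_bij n1 cL cB.
  by rewrite /psi; case: xgetP => [t _ <-//|/(_ (d (c k.+1 l)))]; case; apply: dc.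
have psiP k : (k.+1 < r)%N ->
    [/\ linear (@psi k), bijective (@psi k) & forall l, @wmul F r m L k (psi k l) = phi l].
  move=> kr; have [cL cB] := cP k (ltnW kr); have [c'L c'B] := cP k.+1 kr.
  have tI := bij_inj (tcoord_bij n1 cL cB).
  split.
  - by move=> p l l'; apply: tI; rewrite (tcoord_linear n1 cL) -!psiE // c'L.
  - have [d cd dc] := c'B; exists (d \o tcoord (c k)) => [l|t] /=.
      by rewrite -psiE.
    by apply: tI; rewrite -psiE.
  - by move=> l; apply: (bij_inj cB); rewrite (coord_wmul cL cB) cphi // psiE.
exists psi; first exact: psiP.
move=> k kr; have r0 : (0 < r)%N by apply: leq_ltn_trans kr.
apply: coord_chain => //; first exact: (cP 0 r0).1.
- by move=> j jk; apply: (cP j _).1; apply: leq_ltn_trans kr.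
- by move=> j jk; have [] := psiP j (leq_ltn_trans jk kr).
Qed.
End Frames.

(** * Duality over F[z]/(z^m) *)

Section Trace.
Variables (F : fieldType) (r m : nat).
Hypotheses (r0 : (0 < r)%N) (m0 : (0 < m)%N).
Implicit Types f g p : {poly F}.
Let n := nR r m.
Local Notation R := (wquot F 0 n).
Local Notation O := (O_mx F m).
Local Notation zw := (zw F r).

Let nE : n = (r * m.-1).+1. Proof. by rewrite /n /nR -subn1 mulnBr muln1 mulnC. Qed.

Lemma comp_polyXnM k p f : (comp_poly 'X^k (p * 'X)) * f = comp_poly 'X^k p * ('X^k * f).
Proof. by rewrite comp_polyM comp_polyX mulrA. Qed.

(* The projection of F[w] onto its summand F[z] along w F[z] + ... + w^(r-1) F[z]. *)
Definition wtrace f : {poly F} := \poly_(i < size f) f`_(r * i).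

Lemma coef_wtrace f i : (wtrace f)`_i = f`_(r * i).
Proof.
rewrite coef_poly; case: ltnP => // fi; rewrite nth_default //.
by apply: leq_trans fi _; rewrite leq_pmull.
Qed.

Lemma wtraceD : {morph wtrace : f g / f + g}.
Proof. by move=> f g; apply/polyP => i; rewrite coefD !coef_wtrace coefD. Qed.

Lemma wtraceM p f : wtrace (zw p * f) = p * wtrace f.
Proof.
elim/poly_ind: p f => [|p c IH] f.
  by rewrite rmorph0 !mul0r; apply/polyP => i; rewrite coef_wtrace !coef0.
rewrite rmorphD /= !mulrDl wtraceD comp_polyXnM IH -mulrA comp_polyC.
congr (p * _ + _); apply/polyP => i; last by rewrite !(coef_wtrace, coefCM).
rewrite coef_wtrace coefXM coefXnM coef_wtrace; case: i => [|i].
  by rewrite muln0 r0.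
by rewrite mulnS ltnNge leq_addr /= addKn.
Qed.

Lemma wtraceB f g : wtrace (f - g) = wtrace f - wtrace g.
Proof. by apply/polyP => i; rewrite coefB !coef_wtrace coefB. Qed.

(** For i < m the coefficient of z^i comes from w^(ri), and ri <= r (m - 1) < n. Hence the
    projection descends to F[w]/(w^n) -> F[z]/(z^m). *)
Lemma dvd_wtrace f : 'X^n %| f -> 'X^m %| wtrace f.
Proof.
move=> /dvdXnP nf; apply/dvdXnP => i im; rewrite coef_wtrace nf // nE ltnS.
by rewrite leq_mul2l -ltnS prednK // im orbT.
Qed.

Definition trace (x : R) : O := wcls 0 m (wtrace (wrep x)).

Lemma trace_wcls f : trace (wcls 0 n f) = wcls 0 m (wtrace f).
Proof.
apply/wcls_eq; rewrite ?expr0 ?dvd1p //.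
by rewrite -wtraceB dvd_wtrace // wrep_wcls // expr0 dvd1p.
Qed.

Lemma dvdX0 f : 'X^0 %| f.
Proof. by rewrite expr0 dvd1p. Qed.

Lemma scale_wcls0 b p f : p *: wcls 0 b f = wcls 0 b (p * f).
Proof. by rewrite wclsZ // dvdX0. Qed.

Lemma add_wcls0 b f g : wcls 0 b f + wcls 0 b g = wcls 0 b (f + g).
Proof. by rewrite wclsD // dvdX0. Qed.

Lemma traceP p x y : trace (zw p *: x + y) = p *: trace x + trace y.
Proof.
rewrite -[x]wrepK -[y]wrepK scale_wcls0 add_wcls0 !trace_wcls.
by rewrite scale_wcls0 add_wcls0 wtraceD wtraceM.
Qed.

(* F[w]/(w^n) is a Frobenius algebra over F[z]/(z^m) for this pairing, because
   n - 1 = r (m - 1). *)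
Definition tpair (x y : R) : O := trace (wrep x *: y).

Lemma tpair_wcls f g : tpair (wcls 0 n f) (wcls 0 n g) = wcls 0 m (wtrace (f * g)).
Proof.
rewrite /tpair (@wquot_scale_eq _ _ _ _ f); last by rewrite wrep_wcls ?dvdX0.
by rewrite scale_wcls0 trace_wcls.
Qed.

Lemma tpairC x y : tpair x y = tpair y x.
Proof. by rewrite -[x]wrepK -[y]wrepK !tpair_wcls mulrC. Qed.

Lemma tpairZ p x y : tpair (p *: x) y = tpair x (p *: y).
Proof. by rewrite -[x]wrepK -[y]wrepK !scale_wcls0 !tpair_wcls mulrCA mulrA. Qed.

Lemma tpairPr x p y y' : tpair x (zw p *: y + y') = p *: tpair x y + tpair x y'.
Proof. by rewrite /tpair scalerDr scalerA mulrC -scalerA traceP. Qed.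

Lemma tpairPl x p y y' : tpair (zw p *: y + y') x = p *: tpair y x + tpair y' x.
Proof. by rewrite -!(tpairC x) tpairPr. Qed.

(** Pairing x with w^(r(m-1)-i) moves its coefficient of w^i to w^(r(m-1)), that is, to the top
    coefficient z^(m-1) of the trace. *)
Lemma tpair_nondeg x : (forall y, tpair x y = 0) -> x = 0.
Proof.
move=> x0; rewrite -[x]wrepK; apply/wcls_eq0; first exact: dvdX0.
apply/dvdXnP => i; rewrite [X in (_ < X)%N]nE ltnS => ir.
have := x0 (wcls 0 n 'X^(r * m.-1 - i)); rewrite -{1}[x]wrepK tpair_wcls.
move/(wcls_eq0 m (dvdX0 _))/dvdXnP/(_ m.-1); rewrite coef_wtrace coefMXn.
by rewrite (ltnNge (r * _)) leq_subr /= subKn // prednK // => ->.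
Qed.

Lemma tpair_inj x x' : (forall y, tpair x y = tpair x' y) -> x = x'.
Proof.
move=> h; apply/eqP; rewrite -subr_eq0; apply/eqP/tpair_nondeg => y.
by have := tpairPl y (-1) x' x; rewrite rmorphN1 !scaleN1r addrC => ->; rewrite h addNr.
Qed.

(** An F[z]-linear map to F[z]/(z^m) is determined by its top coefficient l, since the coefficient
    of z^i in xi(f) is l(z^(m-1-i) f). It is therefore enough to represent the F-linear form l as f
    |-> coefficient of w^(r(m-1)) in g f. *)
Lemma tpair_repr (xi : R -> O) :
  (forall p y y', xi (zw p *: y + y') = p *: xi y + xi y') ->
  exists x, xi =1 tpair x.
Proof.
move=> xiP.
have xi0 : xi 0 = 0.
  by have := xiP (-1) 0 0; rewrite scaler0 addr0 scaleN1r addNr.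
have xiD y y' : xi (y + y') = xi y + xi y'.
  by have := xiP 1 y y'; rewrite rmorph1 !scale1r.
have xiZ p y : xi (zw p *: y) = p *: xi y by have := xiP p y 0; rewrite xi0 !addr0.
pose l f := (wrep (xi (wcls 0 n f)))`_m.-1.
(* The coefficients are forced by testing on f = w^j: the coefficient of w^(r(m-1)) in g w^j is that
   of w^(r(m-1)-j) in g. *)
pose g := \poly_(i < n) l 'X^(r * m.-1 - i).
have xiE f i : (i < m)%N -> (wrep (xi (wcls 0 n f)))`_i = l (zw 'X^(m.-1 - i) * f).
  move=> im; rewrite /l -scale_wcls0 xiZ -[xi (wcls 0 n f)]wrepK.
  have : 'X^m %| wrep ('X^(m.-1 - i) *: wcls 0 m (wrep (xi (wcls 0 n f)))) -
                 'X^(m.-1 - i) * wrep (xi (wcls 0 n f)).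
    by rewrite scale_wcls0 wrep_wcls ?dvdX0.
  move/dvdXnP/(_ m.-1); rewrite prednK // leqnn coefB => /(_ isT)/eqP.
  rewrite subr_eq0 => /eqP ->; rewrite wrepK coefXnM ltnNge leq_subr /= subKn //.
  by rewrite -ltnS prednK.
have lD f f' : l (f + f') = l f + l f'.
  rewrite /l -add_wcls0 xiD -[xi (wcls 0 n f)]wrepK -[xi (wcls 0 n f')]wrepK.
  have := wrepP 1 (xi (wcls 0 n f)) (xi (wcls 0 n f')).
  move/dvdXnP/(_ m.-1); rewrite prednK // leqnn coefB => /(_ isT)/eqP.
  by rewrite subr_eq0 scale1r mul1r coefD !wrepK => /eqP.
have lZ a f : l (a *: f) = a * l f.
  rewrite /l -mul_polyC -scale_wcls0 -[a%:P](comp_polyC _ 'X^r) xiZ.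
  have := wrepP a%:P (xi (wcls 0 n f)) 0.
  move/dvdXnP/(_ m.-1); rewrite prednK // leqnn coefB => /(_ isT)/eqP.
  rewrite subr_eq0 addr0 coefD coefCM => /eqP ->.
  suff -> : (wrep (0 : O))`_m.-1 = 0 by rewrite addr0.
  have /dvdXnP -> // : 'X^m %| wrep (0 : O) by apply: dvd_wrep0.
  by rewrite prednK.
have l0 f : 'X^n %| f -> l f = 0.
  move=> nf; have <- : l 0 = 0 by have := lZ 0 0; rewrite scale0r mul0r.
  by rewrite /l; congr ((wrep (xi _))`_ _); apply/wcls_eq; rewrite ?dvdX0 ?subr0.
have lE f : l f = (g * f)`_(r * m.-1).
  rewrite -[f](poly_take_drop n) lD mulrDr coefD [in LHS](l0 (_ * _)) ?dvdp_mull //.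
  have /dvdXnP -> : 'X^n %| g * (drop_poly n f * 'X^n) by rewrite !dvdp_mull.
  2: by rewrite nE.
  rewrite !addr0 coefMr /take_poly poly_def -nE.
  have lsum (s : seq 'I_n) (h : 'I_n -> {poly F}) :
      l (\sum_(i <- s) h i) = \sum_(i <- s) l (h i).
    by apply: (big_morph l lD); have := lZ 0 0; rewrite scale0r mul0r.
  rewrite lsum; apply: eq_bigr => i _; rewrite lZ mulrC; congr (_ * _); last first.
    by rewrite -poly_def coef_poly ltn_ord.
  have ir : (i <= r * m.-1)%N by have := ltn_ord i; rewrite [X in (_ < X)%N]nE.
by rewrite coef_poly [X in (_ < X)%N]nE ltnS leq_subr subKn.
exists (wcls 0 n g) => y; rewrite -[y]wrepK tpair_wcls -[LHS]wrepK.
apply/(wcls_eq m (dvdX0 _) (dvdX0 _))/dvdXnP => i im.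
rewrite coefB xiE // lE mulrCA -coef_wtrace wtraceM coefXnM ltnNge leq_subr /=.
by rewrite subKn ?subrr // -ltnS prednK.
Qed.
End Trace.

Section Duality.
Variables (F : fieldType) (r m : nat).
Hypotheses (r0 : (0 < r)%N) (m0 : (0 < m)%N).
Let n := nR r m.
Local Notation R := (wquot F 0 n).
Local Notation O := (O_mx F m).
Local Notation zw := (zw F r).

(** An identification of the F[z]-module U with F[w]/(w^n) on which z acts as w^r. It presupposes no
    action of w on U, and so can be used to construct one. *)
Definition zcoord (U : lmodType {poly F}) (c : U -> R) : Prop :=
  (forall p v v', c (p *: v + v') = zw p *: c v + c v') /\ bijective c.

Variables (U : lmodType {poly F}) (c : U -> R).
Hypothesis cP : zcoord c.

Lemma zcoord0 : c 0 = 0.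
Proof. exact: semilinear0 cP.1. Qed.

Lemma zcoordZ p v : c (p *: v) = zw p *: c v.
Proof. by have := cP.1 p v 0; rewrite zcoord0 !addr0. Qed.

Lemma zcoordD v v' : c (v + v') = c v + c v'.
Proof. by have := cP.1 1 v v'; rewrite rmorph1 !scale1r. Qed.

Local Notation dual := (linmap U O).

Lemma tpair_linear x : linear (fun v => tpair x (c v)).
Proof. by move=> p v v'; rewrite cP.1 tpairPr. Qed.

Definition dual_of x : dual := Linmap (tpair_linear x).

(** The element representing [xi] for the trace pairing; it exists by [tpair_repr], so the default 0
    is not reached by lack of a witness. *)
Definition dcoord (xi : dual) : R := xget 0 [set x | forall v, xi v = tpair x (c v)]%classic.

Lemma dcoordE (xi : dual) v : xi v = tpair (dcoord xi) (c v).
Proof.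
have [d cd dc] := cP.2.
have [x xP] : exists x, (xi \o d) =1 tpair x.
  apply: tpair_repr => // p y y' /=; rewrite -linearP; congr (xi _).
  by apply: (can_inj cd); rewrite cP.1 !dc.
rewrite /dcoord; case: xgetP => [y _ -> //|/(_ x)]; case=> w.
by rewrite -{1}[w]cd; exact: xP.
Qed.

Lemma dcoord_of x : dcoord (dual_of x) = x.
Proof.
have [d cd dc] := cP.2.
by apply: (tpair_inj r0 m0) => y; rewrite -[y]dc -dcoordE.
Qed.

Lemma dcoord_uniq (xi : dual) x : (forall v, xi v = tpair x (c v)) -> dcoord xi = x.
Proof. by move=> h; rewrite -[RHS]dcoord_of; congr dcoord; apply: hom_ext. Qed.

Lemma dcoord_zcoord : zcoord dcoord.
Proof.
split=> [p xi eta|].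
  by apply: dcoord_uniq => v /=; rewrite tpairPl // -!dcoordE.
exists dual_of => [xi|]; last exact: dcoord_of.
by apply: hom_ext => v /=; rewrite -dcoordE.
Qed.

(** Read on [dual_of], G is an F[z]-linear map on F[w]/(w^n), hence pairing with some y; by symmetry
    of the pairing it is evaluation at the vector of coordinate y. *)
Lemma dual_reflexive (G : linmap dual O) : exists v, forall eta : dual, G eta = eta v.
Proof.
have [d cd dc] := cP.2; have [e ce ec] := dcoord_zcoord.2.
have [y yP] : exists y, (fun x => G (dual_of x)) =1 tpair y.
  apply: tpair_repr => // p x x'; rewrite -linearP; congr (G _).
  by apply: hom_ext => v /=; rewrite tpairPl.
exists (d y) => eta; rewrite dcoordE dc tpairC //.
refine (etrans _ (yP (dcoord eta))); congr (G _).
by apply: hom_ext => v /=; rewrite -dcoordE.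
Qed.

Lemma dual_separated v v' : (forall eta : dual, eta v = eta v') -> v = v'.
Proof.
move=> h; apply: (bij_inj cP.2); apply: (tpair_inj r0 m0) => y.
by rewrite !(tpairC r0 m0 _ y); apply: (h (dual_of y)).
Qed.

(** This gives [theta] its meaning: reflexivity makes the choice by [xget] succeed, separation makes
    it unique and hence linear, so [homof] does not fall back to 0. *)
Lemma bidual_xget (W : lmodType {poly F}) (b : linmap W (linmap dual O)) xi :
  forall eta : dual, b xi eta =
  eta (homof (fun xi => xget 0 [set v | forall eta : dual, b xi eta = eta v]%classic) xi).
Proof.
pose t xi := xget 0 [set v | forall eta : dual, b xi eta = eta v]%classic.
have tP x : forall eta : dual, b x eta = eta (t x).
  rewrite /t; case: xgetP => [v _ //|].
  by have [v vP] := dual_reflexive (b x); move/(_ v vP).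
have tL : linear t.
  move=> p x y; apply: dual_separated => eta.
  by rewrite -tP linearP [RHS]linearP /= -!tP.
by rewrite (homofE tL).
Qed.
End Duality.

(** * Filtrations *)

Section LengthOne.
Variables (A : comNzRingType) (M : lmodType A).

Lemma scaledP (a : A) (V : submodule M) x :
  x \in scaled a V <-> exists2 y, y \in V & x = a *: y.
Proof. by split=> [/asboolP|h]; [| apply/asboolP]. Qed.

(** With y any nonzero element, an x outside the submodule spanned by y would give the strict chain
    0, A y, M of length 2. *)
Lemma length1_cyclic : has_length M 1 -> exists y : M, forall x, exists p, x = p *: y.
Proof.
case=> -[c /(_ 0 isT)[_ [y _ yc0]]] lmax; exists y => x; apply: contrapT => xy.
have y0 : y != 0 by apply: contraNneq yc0 => ->; apply: rpred0.
have zP : submod_closed [pred x : M | x == 0].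
  split=> [|a u v]; rewrite !inE; first exact: eqxx.
  by move=> /eqP-> /eqP->; rewrite scaler0 addr0.
have yP : submod_closed [pred x : M | `[< exists p, x = p *: y >]].
  split=> [|a u v]; first by apply/asboolP; exists 0; rewrite scale0r.
  move=> /asboolP[p ->] /asboolP[q ->]; apply/asboolP; exists (a * p + q).
  by rewrite scalerDl scalerA.
have tP : submod_closed (predT : {pred M}) by [].
pose d i := match i with 0 => Submodule zP | 1 => Submodule yP | _ => Submodule tP end.
suff /(lmax d) : strict_chain d 2 by [].
case=> [_|[_|//]]; split.
- by move=> u /eqP ->; apply/asboolP; exists 0; rewrite scale0r.
- by exists y => //; apply/asboolP; exists 1; rewrite scale1r.
- by [].
- by exists x => //; apply/asboolPn.
Qed.
End LengthOne.

Section Filtrations.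
Variables (F : fieldType) (r m : nat) (E : lmodType {poly F}).
Variables (nabla : linmap E E) (V : filtration r E).
Hypotheses (r0 : (0 < r)%N) (m0 : (0 < m)%N) (VP : is_filtration nabla V).

Lemma fil_mono j k : (j <= k <= r)%N -> {subset fil V k <= fil V j}.
Proof.
have [_ VS _ _ _] := VP.
elim: k => [|k IH] /andP[]; first by rewrite leqn0 => /eqP -> _ v.
rewrite leq_eqVlt => /orP[/eqP -> _ v //|jk kr] v /(VS k kr); apply: IH.
by rewrite -ltnS jk ltnW.
Qed.

Lemma fil_X k v : (k <= r)%N -> 'X *: v \in fil V k.
Proof.
have [V0 _ Vr _ _] := VP => kr; apply: (@fil_mono k r); first by rewrite kr leqnn.
by rewrite Vr; apply/asboolP; exists v.
Qed.

(** The quotient V_k/V_(k+1) is cyclic over F[z], and z kills it because z V_0 = V_r lies in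
    V_(k+1); hence the constant term of a coefficient suffices. *)
Lemma fil_gen k : (k < r)%N -> exists2 e, e \in fil V k &
  forall v, v \in fil V k -> exists a : F, v - a%:P *: e \in fil V k.+1.
Proof.
have [V0 VS _ Vl _] := VP => kr; have [y yP] := length1_cyclic (Vl k kr).
exists (rep y) => [|v vV]; first exact: rep_in.
have [p vp] := yP (cls (fil V k) (fil V k.+1) v).
have [q [a pE]] : exists q (a : F), p = q * 'X + a%:P.
  by elim/poly_ind: (p) => [|q a _]; [exists 0, 0; rewrite mul0r add0r | exists q, a].
exists a; have -> : v - a%:P *: rep y = v - p *: rep y + q *: ('X *: rep y).
  by rewrite pE scalerDl opprD addrA addrAC -scalerA subrK.
apply: rpredD; last exact/rpredZ/fil_X.
apply/(cls_eq (fil V k.+1) vV); first by rewrite rpredZ // rep_in.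
by rewrite clsZ ?rep_in // repK.
Qed.

Lemma Vcls_linear k p v v' : v \in fil V k -> v' \in fil V k ->
  Vcls m V k (p *: v + v') = p *: Vcls m V k v + Vcls m V k v'.
Proof. exact: clsP. Qed.

Lemma Vcls_eq k v v' : v \in fil V k -> v' \in fil V k ->
  Vcls m V k v = Vcls m V k v' <-> v - v' \in scaled 'X^(m.-1) (fil V k.+1).
Proof. exact: cls_eq. Qed.

Lemma Vcls_surj k (q : Vbar m V k) : exists2 v, v \in fil V k & q = Vcls m V k v.
Proof. by exists (rep q); [exact: rep_in | rewrite /Vcls repK]. Qed.

Lemma iotaE k v : (k.+1 < r)%N -> v \in fil V k.+1 ->
  Defs.iota (Vcls m V k.+1 v) = Vcls m V k v.
Proof.
move=> kr vV; have sk : {subset fil V k.+1 <= fil V k} by apply: fil_mono; rewrite leqnSn ltnW.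
apply/Vcls_eq; [exact/sk/rep_in | exact: sk |].
have /scaledP[y yV e] := rep_cls (scaled 'X^(m.-1) (fil V k.+2)) vV.
by apply/scaledP; exists y => //; apply: fil_mono yV; rewrite leqnSn.
Qed.

Lemma iota_linear k : (k.+1 < r)%N -> linear (@Defs.iota F r m E V k).
Proof.
move=> kr p q q'; have [v vV ->] := Vcls_surj q; have [v' vV' ->] := Vcls_surj q'.
have sk : {subset fil V k.+1 <= fil V k} by apply: fil_mono; rewrite leqnSn ltnW.
by rewrite -Vcls_linear // !iotaE ?rpredD ?rpredZ // Vcls_linear ?sk.
Qed.

(** Well-definedness of [iotar]: changing v by z^(m-1) V_1 and multiplying by p in (z), or changing
    p by z^(m+1), alters the product by an element of z^(m-1) V_r, as z V_0 = V_r. *)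
Lemma iotar_cls p v p' v' : 'X %| p -> 'X^(m.+1) %| p - p' ->
  Vcls m V 0 v = Vcls m V 0 v' -> Vcls m V r.-1 (p *: v) = Vcls m V r.-1 (p' *: v').
Proof.
have [V0 _ Vr _ _] := VP.
move=> Xp pp' /(Vcls_eq (V0 v) (V0 v'))/scaledP[y yV vv'].
have Vp q w : 'X %| q -> q *: w \in fil V r.-1.
  by move=> /dvdpP[a ->]; rewrite -scalerA rpredZ // fil_X ?leq_pred.
have Xp' : 'X %| p'.
  have : 'X %| p - p' by apply: dvdp_trans pp'; rewrite exprS dvdp_mulr.
  by rewrite dvdp_subr.
apply/Vcls_eq; [exact: Vp | exact: Vp |]; rewrite prednK //; apply/scaledP.
have /dvdpP[a pE] := Xp; have /dvdpP[b ppE] := pp'.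
exists (a *: ('X *: y) + (b * 'X) *: ('X *: v')).
  by apply: rpredD; apply/rpredZ/fil_X.
have -> : p *: v - p' *: v' = p *: (v - v') + (p - p') *: v'.
  by rewrite scalerBr scalerBl addrA subrK.
rewrite vv' ppE {1}pE scalerDr !scalerA -{2}(prednK m0) !exprS; congr (_ *: _ + _ *: _); ring.
Qed.

Lemma rep_Vcls k v : v \in fil V k ->
  Vcls m V k (@rep _ _ (fil V k) _ (Vcls m V k v)) = Vcls m V k v.
Proof. by move=> vV; rewrite /Vcls repK. Qed.

Lemma fil_pred p v : 'X %| p -> p *: v \in fil V r.-1.
Proof. by move=> /dvdpP[a ->]; rewrite -scalerA rpredZ // fil_X ?leq_pred. Qed.

Lemma iotar_bilinear : bilinear_map (fun (p : wquot F 1 m.+1) (q : Vbar m V 0) =>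
  Vcls m V r.-1 (wrep p *: @rep _ _ (fil V 0) _ q)).
Proof.
have [V0 _ _ _ _] := VP.
split=> [q a p p'|p a q q'].
  rewrite -Vcls_linear ?fil_pred ?wrep_dvdX // scalerA -scalerDl.
  by apply: iotar_cls; rewrite ?wrep_dvdX ?wrepP.
rewrite -Vcls_linear ?fil_pred ?wrep_dvdX // scalerA mulrC -scalerA -scalerDr.
apply: iotar_cls; rewrite ?wrep_dvdX ?subrr ?dvdp0 //.
by rewrite /Vcls repK clsP ?rep_in // !repK.
Qed.

Lemma iotar_linear : linear (@iotar F r m E V).
Proof. exact/tlift_linear/iotar_bilinear. Qed.

Lemma iotarE p v : 'X %| p -> iotar (wcls 1 m.+1 p ⊗ Vcls m V 0 v) = Vcls m V r.-1 (p *: v).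
Proof.
have [V0 _ _ _ _] := VP => Xp.
rewrite /iotar tliftE; last exact: iotar_bilinear.
by apply: iotar_cls; rewrite ?wrep_dvdX ?wrep_wcls ?rep_Vcls.
Qed.
End Filtrations.

(** * Polynomials in an endomorphism and cyclic modules *)

Section PolynomialAction.
Variables (F : fieldType) (U : lmodType {poly F}) (N : linmap U U).

Lemma polyactXn i u : polyact N 'X^i u = iter i N u.
Proof.
elim: i u => [|i IH] u; first by rewrite expr0 polyact1.
by rewrite exprS mulrC polyactMX IH iterSr.
Qed.

Lemma polyact_zw r : (forall u, iter r N u = 'X *: u) ->
  forall p u, polyact N (zw F r p) u = p *: u.
Proof.
move=> Nr p u; rewrite /zw /=; elim/poly_ind: p u => [|p c IH] u.
  by rewrite comp_poly0 scale0r -(@polyC0 F) polyactC polyC0 scale0r.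
rewrite comp_polyD comp_polyM comp_polyX comp_polyC polyactDl -polyactA polyactC.
by rewrite polyactXn Nr IH scalerDl scalerA.
Qed.

Lemma polyact_dvd n : (forall u, iter n N u = 0) ->
  forall p u, 'X^n %| p -> polyact N p u = 0.
Proof.
move=> Nn p u /dvdpP[q ->]; rewrite mulrC -polyactA polyactXn; exact: Nn.
Qed.

Lemma polyact_eq n p q u : (forall u, iter n N u = 0) ->
  'X^n %| p - q -> polyact N p u = polyact N q u.
Proof.
move=> Nn pq; have -> : p = (p - q) + q by rewrite subrK.
by rewrite polyactDl (polyact_dvd Nn) // add0r.
Qed.

Lemma polyact_linear p : linear (polyact N p).
Proof. by move=> a u v; rewrite polyactDr polyactZ. Qed.
End PolynomialAction.

Lemma polyact_comm (F : fieldType) (U U' : lmodType {poly F}) (N : linmap U U)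
    (N' : linmap U' U') (f : U -> U') : linear f -> (forall u, f (N u) = N' (f u)) ->
  forall p u, f (polyact N p u) = polyact N' p (f u).
Proof.
move=> fL fN p u; have fI i : f (iter i N u) = iter i N' (f u).
  by elim: i => // i IH; rewrite !iterS fN IH.
rewrite /polyact (big_morph f (linear_mapD fL) (linear_map0 fL)).
apply: eq_bigr => i _ /=.
by rewrite linear_mapZ // fI.
Qed.

Section Cyclic.
Variables (F : fieldType) (n : nat) (L : lmodType {poly F}).
Local Notation R := (wquot F 0 n).

Lemma inv_linear (M : lmodType {poly F}) (f : M -> L) : linear f -> bijective f ->
  exists g : L -> M, [/\ linear g, bijective g & cancel f g].
Proof.
move=> fL fB; have [g fg gf] := fB; exists g; split=> //; last by exists f.
by move=> p x y; apply: (bij_inj fB); rewrite fL !gf.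
Qed.

Lemma cyclic_coord (u : L) : (forall l, exists f, l = f *: u) ->
  (forall f, f *: u = 0 <-> 'X^n %| f) ->
  exists c : L -> R, linear c /\ bijective c.
Proof.
move=> gen ann; pose e (q : R) := wrep q *: u.
have eE p q : 'X^n %| p - q -> p *: u = q *: u.
  by move=> /ann; rewrite scalerBl => /eqP; rewrite subr_eq0 => /eqP.
have eL : linear e by move=> p x y; rewrite /e scalerA -scalerDl; apply/eE/wrepP.
have [|c [cL cB _]] := inv_linear eL; last by exists c.
have xP l : exists x, e x = l.
  have [f ->] := gen l; exists (wcls 0 n f).
  by apply/eE; rewrite wrep_wcls // expr0 dvd1p.
exists (fun l => xget 0 [set x | e x = l]%classic) => [x|l]; last first.
  by case: xgetP => [y _ //|]; have [x xl /(_ x)] := xP l.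
case: xgetP => [y _ |/(_ x)]; last by case.
move=> /eqP; rewrite -subr_eq0 -scalerBl => /eqP/ann yx.
by rewrite -[y]wrepK -[x]wrepK; apply/wcls_eq; rewrite ?wrep_dvd.
Qed.
End Cyclic.

(** Each term of the formal sum has its first component in (w). This form requires no coordinates,
    which are not yet available in the Nakayama argument that uses it. *)
Lemma wmul_dvd (F : fieldType) r m (L : nat -> lmodType {poly F}) k t :
  exists l, @wmul F r m L k t = 'X *: l.
Proof.
rewrite /wmul /tlift /formal_sum; elim/big_ind: _ => [|x y [l ->] [l' ->]|q _].
- by exists 0; rewrite scaler0.
- by exists (l + l'); rewrite scalerDr.
- by exists ((wrep q.1 %/ 'X) *: q.2); rewrite scalerA mulrC divpK ?wrep_dvdX.
Qed.

(** * From factorized to generic structures *)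

Section Factorized.
Variables (F : fieldType) (r m : nat) (E : lmodType {poly F}).
Variables (nabla : linmap E E) (nu : nat -> {poly F}) (V : filtration r E).
Variable s : factorized_data m V.
Hypotheses (r1 : (1 < r)%N) (m0 : (0 < m)%N) (sP : is_factorized_on nabla nu s).
Let n := nR r m.
Let r0 : (0 < r)%N. Proof. exact: ltnW. Qed.
Local Notation iota := (@Defs.iota F r m E V _).
Local Notation U := (wVbar s).

Let VP : is_filtration nabla V. Proof. by case: sP. Qed.

Lemma homcompE (A : comNzRingType) (M N P : lmodType A) (g : linmap N P) (f : linmap M N) x :
  homcomp g f x = g (f x).
Proof. by rewrite /homcomp homofE //; apply: comp_linear; apply: homP. Qed.

Lemma NopE k j : (k + j).+1 = r -> forall v, Nop s k v = theta s k j (varkappa s k j v).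
Proof.
by move=> kj v; rewrite /Nop homcompE; have -> : (r - k.+1)%N = j by rewrite -kj subSS addKn.
Qed.

Lemma iota_Nop k v : (k.+1 < r)%N -> iota (Nop s k.+1 v) = Nop s k (iota v).
Proof.
move=> kr; have [_ [_ _ thI _] [_ kaI _] _ _] := sP.
pose j := (r - k.+2)%N.
have kj : (k + j).+2 = r by rewrite /j -!addSn subnKC.
by rewrite (@NopE k.+1 j) ?(@NopE k j.+1) -?thI ?kaI // ?addSn ?addnS.
Qed.

Lemma iotar_Nop t : iotar (tmap id (Nop s 0) t) = Nop s r.-1 (iotar t).
Proof.
have [_ [_ _ _ thR] [_ _ kaR] _ _] := sP.
rewrite (@NopE r.-1 0) ?addn0 ?prednK // kaR thR; congr iotar.
elim/tens_ind: t => [|x y ex ey|p v].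
- by rewrite !linear_map0 //; do ?apply: tmap_linear => //; apply: homP.
- by rewrite !linear_mapD ?ex ?ey //; do ?apply: tmap_linear => //; apply: homP.
rewrite !tmapE //; try exact: homP.
by rewrite (@NopE 0 r.-1) ?prednK.
Qed.

Lemma Nop_iter_r k v : (k < r)%N -> iter r (Nop s k) v = 'X *: v.
Proof. by move=> kr; have [_ _ _ /(_ k kr)[] ] := sP. Qed.

Lemma Nop_iter_n k v : (k < r)%N -> iter n (Nop s k) v = 0.
Proof. by move=> kr; have [_ _ _ /(_ k kr)[] ] := sP. Qed.

Lemma iota_wlinear k : (k.+1 < r)%N -> linear (iota : U k.+1 -> U k).
Proof.
move=> kr p v v'; rewrite [LHS](linear_mapD (iota_linear VP kr)); congr (_ + _).
apply: (polyact_comm (N := Nop s k.+1) (N' := Nop s k) (iota_linear VP kr)) => u.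
exact: iota_Nop.
Qed.

Lemma iotar_polyact f p v :
  iotar (p ⊗ polyact (Nop s 0) f v) = polyact (Nop s r.-1) f (iotar (p ⊗ v)).
Proof.
have fL : linear (fun v => iotar (p ⊗ v) : Vbar m V r.-1).
  by move=> a u u'; rewrite tens_linr (iotar_linear r0 m0 VP).
apply: (polyact_comm (f := fun v => iotar (p ⊗ v)) fL) => u.
by rewrite -iotar_Nop tmapE //; exact: homP.
Qed.

(* Nakayama: by the twist psi_1, w Vbar_0 is the image of Vbar_1, of colength one. *)
Lemma wVbar0_cyclic : exists c0 : U 0 -> wquot F 0 n, linear c0 /\ bijective c0.
Proof.
have [_ _ _ /(_ 0 r0)[_ _ ann _] [psi psiP _]] := sP.
have [_ pB pE] := psiP 0 r1.
have [e eV eP] := fil_gen VP r0; pose u : U 0 := Vcls m V 0 e.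
have step (v : U 0) : exists f v', v = f *: u + 'X *: v' :> U 0.
  have [w wV ->] := Vcls_surj v; have [a aw] := eP w wV.
  have [v' v'E] := wmul_dvd (psi 0 (Vcls m V 1 (w - a%:P *: e))).
  exists a%:P, v'; rewrite -v'E pE (iotaE m VP) //.
  have -> : a%:P *: u = Vcls m V 0 (a%:P *: e).
    by rewrite [LHS]polyactC -clsZ.
  rewrite -[LHS]/(Vcls m V 0 w); have [V0 _ _ _ _] := VP.
  by rewrite -[RHS]clsD ?V0 // addrC subrK.
(* Iterated n times, the remainder lies in w^n Vbar_0, which vanishes since N_0^n = 0. *)
have steps j (v : U 0) : exists f v', v = f *: u + 'X^j *: v' :> U 0.
  elim: j => [|j [f [v' ->]]]; first by exists 0, v; rewrite scale0r add0r expr0 scale1r.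
  have [g [w ->]] := step v'; exists (f + 'X^j * g), w.
  by rewrite scalerDr scalerDl !scalerA addrA exprSr.
have Xn (v : U 0) : 'X^n *: v = 0 by rewrite [LHS]polyactXn Nop_iter_n.
have gen (v : U 0) : exists f, v = f *: u.
  by have [f [v' ->]] := steps n v; exists f; rewrite Xn addr0.
apply: (cyclic_coord gen) => f; split=> [fu|/dvdpP[g ->]].
  (* A polynomial killing the generator kills the whole module, and F[w]/(w^n) acts faithfully. *)
  apply: ann => v; have [g ->] := gen v.
  by rewrite -[LHS]/(f *: (g *: u)) scalerA mulrC -scalerA fu scaler0.
by rewrite -scalerA Xn scaler0.
Qed.

Lemma factorized_frame : exists psi c,
  [/\ @is_twist F r m U psi (fun k => iota),
      @frame F r m U (fun k => iota)
        (fun v : U 0 => iotar (wcls 1 m.+1 'X ⊗ (v : Vbar m V 0)) : U r.-1) c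
    & forall l, tcoord (c 0) (chain psi l) = c r.-1 l].
Proof.
have [c0 [c0L c0B]] := wVbar0_cyclic.
have [_ _ _ _ [psi psiP psiC]] := sP; exists psi.
pose phir (v : U 0) : U r.-1 := iotar (wcls 1 m.+1 'X ⊗ (v : Vbar m V 0)).
have phirE v : chain psi (phir v) = wcls r.-1 (n + r.-1) 'X^r ⊗ v.
  have -> : 'X^r = zw F r 'X by rewrite /zw /= comp_polyX.
  exact: psiC.
by have [c cP cchain] := twist_frame r0 c0L c0B psiP phirE; exists c.
Qed.

(** The relation N_k^r = z turns F[w]-linearity of c_k into semilinearity over F[z]. *)
Lemma frame_zcoord (phi : forall k, U k.+1 -> U k) phir c :
  @frame F r m U phi phir c -> forall k, (k < r)%N -> zcoord (U := Vbar m V k) (c k).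
Proof.
move=> [cP _ _] k kr; have [cL cB] := cP k kr; split=> // p v v'.
by rewrite -cL; congr (c k (_ + _)); rewrite [RHS]polyact_zw // => u; apply: Nop_iter_r.
Qed.
End Factorized.

Lemma ext_ind (F : fieldType) r m (E : lmodType {poly F}) (V : filtration r E) k
    (P : ext m V k -> Prop) :
  P 0 -> (forall x y, P x -> P y -> P (x + y)) ->
  (forall v f, P (btens (zw F r) v f)) -> forall t, P t.
Proof. exact: tens_ind. Qed.

Section ExtMap.
Variables (F : fieldType) (r m : nat) (E : lmodType {poly F}) (V : filtration r E).
Let n := nR r m.
Let zw := zw F r.

Lemma additive0 (T T' : zmodType) (f : T -> T') : {morph f : x y / x + y} -> f 0 = 0.
Proof. by move=> fD; apply: (addrI (f 0)); rewrite -fD !addr0. Qed.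

(** V_k ⊗ R is a tensor product over F[z] but is used as an F[w]-module; comparing maps as additive
    ones avoids mixing the two rings. *)
Lemma ext_additive_eq k (L : zmodType) (f g : ext m V k -> L) :
  {morph f : x y / x + y} -> {morph g : x y / x + y} ->
  (forall v q, f (btens zw v q) = g (btens zw v q)) -> f =1 g.
Proof.
move=> fD gD fg; elim/ext_ind=> [|x y fx fy|//]; first by rewrite !additive0.
by rewrite fD gD fx fy.
Qed.

Lemma ext_linear k (L : lmodType {poly F}) (f : ext m V k -> L) :
  {morph f : x y / x + y} ->
  (forall p v q, f (btens zw v (p *: q)) = p *: f (btens zw v q)) -> linear f.
Proof.
move=> fD fZ p x y; rewrite fD; congr (_ + _).
apply: (ext_additive_eq (f := fun x => f (p *: x)) (g := fun x => p *: f x)) => [u v|u v|v q].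
- by rewrite scalerDr fD.
- by rewrite fD scalerDr.
by rewrite -fZ; congr f; apply: btensor_scaleE.
Qed.

Variables (k k' : nat) (f : E -> E).
Hypotheses (fL : linear f) (fV : forall v, v \in fil V k -> f v \in fil V k').

Lemma subm_map_linear : linear (subm_map (V := fil V k) (fil V k') f).
Proof.
move=> p u v; apply: val_inj.
rewrite subm_valP /subm_map !val_tosubm ?fV ?(valP (_ : subm _)) //.
by rewrite subm_valP fL.
Qed.

Lemma ext_mapE v q : ext_map k' f (btens zw v q : ext m V k) =
  btens zw (subm_map (fil V k') f v) q.
Proof. by rewrite /ext_map [LHS]tmapE //; apply: subm_map_linear. Qed.

Lemma ext_mapD : {morph (ext_map k' f : ext m V k -> ext m V k') : x y / x + y}.
Proof.
apply: (@linear_mapD _ (tensor _ _) (tensor _ _)).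
by apply: tmap_linear => //; apply: subm_map_linear.
Qed.

Lemma val_subm_map (v : subm (fil V k)) : val (subm_map (fil V k') f v) = f (val v).
Proof. by rewrite val_tosubm // fV //; apply: valP. Qed.
End ExtMap.

Section Correspondence.
Variables (F : fieldType) (r m : nat) (E : lmodType {poly F}).
Variables (nabla : linmap E E) (nu : nat -> {poly F}) (V : filtration r E).
Variable s : factorized_data m V.
Hypotheses (r1 : (1 < r)%N) (m0 : (0 < m)%N) (sP : is_factorized_on nabla nu s).
Let n := nR r m.
Let r0 : (0 < r)%N. Proof. exact: ltnW. Qed.
Local Notation iota := (@Defs.iota F r m E V _).
Local Notation U := (wVbar s).
Local Notation g := (correspondence_on s).
Local Notation gphirg := (@gphir _ _ _ _ _ g).
Let zw := zw F r.

Let VP : is_filtration nabla V. Proof. by case: sP. Qed.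

Lemma corr_gpi_bilinear k : (k < r)%N ->
  bilinear_map (fun (v : subm (fil V k)) (f : restr (wquot F 0 n) zw) =>
       polyact (Nop s k) (wrep f) (Vcls m V k (val v))).
Proof.
move=> kr; have Nn := Nop_iter_n sP (k := k) ^~ kr; have Nr := Nop_iter_r sP (k := k) ^~ kr.
split=> [f p v v'|v p f f'].
  by rewrite subm_valP Vcls_linear ?(valP (_ : subm _)) // polyact_linear.
rewrite (polyact_eq _ Nn (wrepP (zw p) _ _)) polyactDl; congr (_ + _).
by rewrite -polyactA polyact_zw.
Qed.

Lemma corr_gpiE k v f : (k < r)%N -> gpi g (btens zw v f : ext m V k) =
  polyact (Nop s k) (wrep f) (Vcls m V k (val v)).
Proof. move=> kr; exact: (@tliftE _ _ _ (Vbar m V k) _ _ _ (corr_gpi_bilinear kr)). Qed.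

Lemma corr_gpi_linear k : (k < r)%N -> linear (@gpi _ _ _ _ _ g k).
Proof.
move=> kr; apply: ext_linear => [|p v f].
  by apply: (@linear_mapD _ (tensor _ _) (Vbar m V k)); apply/tlift_linear/corr_gpi_bilinear.
rewrite !corr_gpiE // [RHS]polyactA.
have Nn := Nop_iter_n sP (k := k) ^~ kr.
exact: polyact_eq Nn (wrepZ _ _).
Qed.

Lemma corr_gpi1 k (v : subm (fil V k)) : (k < r)%N ->
  gpi1 g v = Vcls m V k (val v) :> Vbar m V k.
Proof.
move=> kr; have Nn := Nop_iter_n sP (k := k) ^~ kr.
rewrite /gpi1 corr_gpiE // -[RHS](polyact1 (Nop s k)).
by apply: (polyact_eq _ Nn); rewrite wrep_wcls // expr0 dvd1p.
Qed.

Variable c : forall k, U k -> wquot F 0 n.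
Hypothesis cP : @frame F r m U (fun k => iota)
  (fun v : U 0 => iotar (wcls 1 m.+1 'X ⊗ (v : Vbar m V 0)) : U r.-1) c.

(** Makes (w^r)/(w^(mr+1)) free of rank one over F[w]/(w^n), so that [tcoord] applies to the source
    of φ_r. *)
Let nr : (m * r).+1 = (n + r)%N.
Proof. by rewrite /n /nR addSn subnK // leq_pmull. Qed.

Let rr : (r.-1 < r)%N. Proof. by rewrite prednK. Qed.

Let BE (q : wquot F r (m * r).+1) (v : U 0) :
  @c r.-1 (iotar (wcls 1 m.+1 'X ⊗ polyact (Nop s 0) (wrep q %/ 'X^r) v)) =
  'X *: ((wrep q %/ 'X^r) *: @c 0 v).
Proof.
have [cB _ cR] := cP; rewrite -(linear_mapZ (cB 0 r0).1).
exact: cR.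
Qed.

Lemma coord_gphir t : @c r.-1 (gphirg t) = 'X *: tcoord (@c 0) t.
Proof.
have [cB _ cR] := cP; have [cL' cB'] := cB r.-1 rr.
exact: (coord_tlift nr (cB 0 r0).1 cL' cB' BE).
Qed.

Lemma corr_gphir_linear : linear (gphirg).
Proof.
have [cB _ cR] := cP; have [cL' cB'] := cB r.-1 rr.
exact/tlift_linear/(bilinear_of_coord nr (cB 0 r0).1 cL' cB' BE).
Qed.

Lemma corr_gphir_image (l' : U r.-1) :
  (exists t, gphirg t = l') <-> exists l, l' = 'X *: l :> U r.-1.
Proof.
have [cB _ cR] := cP; have [cL' cB'] := cB r.-1 rr.
have [d _ dc] := tcoord_bij nr (cB 0 r0).1 (cB 0 r0).2; have [d' _ dc'] := cB'.
split=> [[t <-]|[l ->]].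
  exists (d' (tcoord (@c 0) t)); apply: (bij_inj cB').
  by rewrite coord_gphir linear_mapZ // dc'.
exists (d (@c r.-1 l)); apply: (bij_inj cB').
by rewrite coord_gphir linear_mapZ // dc.
Qed.

(** The formula does not mention the coordinates that prove it, so it allows φ_r to be compared
    between structures with different coordinates. *)
Lemma corr_gphirE f (v : U 0) : gphirg (wcls r (m * r).+1 (f * 'X^r) ⊗ v) =
  polyact (Nop s r.-1) f (iotar (wcls 1 m.+1 'X ⊗ (v : Vbar m V 0))).
Proof.
have [cB _ cR] := cP; have [cL' cB'] := cB r.-1 rr.
apply: (bij_inj cB'); rewrite coord_gphir (tcoord_wcls nr (cB 0 r0).1).
by rewrite [RHS](linear_mapZ cL') cR !scalerA mulrC.
Qed.

Lemma corr_gphir_gpi (p : {poly F}) (t : ext m V 0) : 'X %| p ->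
  gphirg (wcls r (m * r).+1 (zw p) ⊗ gpi g t) = gpi g (ext_map r.-1 ( *:%R p) t).
Proof.
move=> Xp; have fL : linear ( *:%R p : E -> E) by move=> a u v; rewrite scalerDr !scalerA mulrC.
have fV v : v \in fil V 0 -> p *: v \in fil V r.-1 by move=> _; apply: (fil_pred VP).
have gL := corr_gpi_linear.
move: t; apply: ext_additive_eq => [x y|x y|v q].
- by rewrite (linear_mapD (gL _ r0)) tensDr (linear_mapD corr_gphir_linear).
- by rewrite (ext_mapD fL fV) (linear_mapD (gL _ rr)).
rewrite (ext_mapE fL fV) !corr_gpiE // (val_subm_map fV).
have /dvdpP[p' pE] := Xp.
have -> : zw p = zw p' * 'X^r by rewrite pE /zw /= comp_polyM comp_polyX.
rewrite [LHS]corr_gphirE polyact_zw; last by move=> u; apply: (Nop_iter_r sP).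
have [V0 _ _ _ _] := VP.
rewrite (iotar_polyact r1 m0 sP) (iotarE r0 m0 VP) // -polyactZ.
apply: (f_equal (polyact (Nop s r.-1) (wrep q))).
by rewrite pE -clsZ ?scalerA // (fil_X VP) // leq_pred.
Qed.

Lemma corr_gpi_nabla k (t : ext m V k) : (k < r)%N ->
  gpi g (ext_map k nabla t) = exponent r m nu k *: gpi g t.
Proof.
move=> kr; have fL := homP nabla; have gL := corr_gpi_linear kr.
have fV v : v \in fil V k -> nabla v \in fil V k by have [_ _ _ _] := VP; apply.
move: t; apply: ext_additive_eq => [x y|x y|v q].
- by rewrite (ext_mapD fL fV) (linear_mapD gL).
- by rewrite (linear_mapD gL) scalerDr.
rewrite (ext_mapE fL fV) !corr_gpiE // (val_subm_map fV).
have [_ _ _ /(_ k kr)[_ _ _ nuP] _] := sP; rewrite (nuP _ (valP v)).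
by rewrite [RHS]polyactA polyactA mulrC.
Qed.

Lemma corr_gpi_iota k (t : ext m V k.+1) : (k.+1 < r)%N ->
  iota (gpi g t) = gpi g (ext_map k id t).
Proof.
move=> kr; have kr' := ltnW kr; have gL := corr_gpi_linear.
have fV v : v \in fil V k.+1 -> v \in fil V k.
  by apply: (fil_mono VP); rewrite leqnSn ltnW.
have fL := @id_linear _ E; have iL : linear (@Defs.iota F r m E V k) := iota_linear VP kr.
move: t; apply: (ext_additive_eq (L := Vbar m V k)) => [x y|x y|v q].
- by rewrite (linear_mapD (gL _ kr)) [LHS](linear_mapD iL).
- by rewrite (ext_mapD fL fV) [LHS](linear_mapD (gL _ kr')).
rewrite (ext_mapE fL fV) !corr_gpiE // (val_subm_map fV).
have iN (u : Vbar m V k.+1) := iota_Nop sP u kr.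
by rewrite [LHS](polyact_comm iL iN) (iotaE m VP) //; apply: valP.
Qed.
End Correspondence.

Section GenericStructure.
Variables (F : fieldType) (r m : nat) (E : lmodType {poly F}).
Variables (nabla : linmap E E) (nu : nat -> {poly F}) (V : filtration r E).
Hypotheses (r1 : (1 < r)%N) (m0 : (0 < m)%N).
Let n := nR r m.

Lemma correspondence_generic (s : factorized_data m V) :
  is_factorized_on nabla nu s -> is_generic_on nabla nu (correspondence_on s).
Proof.
move=> sP; have r0 := ltnW r1; have VP : is_filtration nabla V by case: sP.
have [psi [c [psiP cP cchain]]] := factorized_frame r1 sP.
have [cB cphi cR] := cP.
split=> //.
- move=> k kr; split.
  + exact: corr_gpi_linear sP _ kr.
  + have [cL cb] := cB k kr; have [d [dL db _]] := inv_linear cL cb.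
    by exists d.
  + move=> l; have [v vV ->] := Vcls_surj (l : Vbar m V k).
    by exists (tosubm (fil V k) v); rewrite [LHS](corr_gpi1 sP) // val_tosubm.
  + by move=> t; apply: corr_gpi_nabla.
- move=> k kr; split.
  + exact: (iota_wlinear sP).
  + exact: frame_image cP kr.
  + by move=> t; apply: (corr_gpi_iota sP).
- split.
  + exact: corr_gphir_linear cP.
  + exact: corr_gphir_image cP.
  + by move=> p t; apply: (corr_gphir_gpi r1 m0 sP cP).
exists psi => // t; have r10 : (r.-1 < r)%N by rewrite prednK.
have [c0L c0B] := cB 0 r0.
(* In coordinates the left side is φ_r, multiplication by w. On the right an element of (w^r) is
   divided by w^(r-1) instead of w^r, which gives the same w. *)
apply: (bij_inj (tcoord_bij (erefl (n + r.-1)%N) c0L c0B)).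
rewrite [LHS]cchain (coord_gphir r1 m0 cP).
have nr : (m * r).+1 = (n + r)%N by rewrite /n /nR addSn subnK // leq_pmull.
have jL : linear (fun q : wquot F r (m * r).+1 => wcls r.-1 (n + r.-1) (wrep q)).
  by apply: wquot_sub_linear; rewrite ?leq_pred // nr leq_add2l leq_pred.
move: t; refine (@tensor_linear_ext _ (wquot F r (m * r).+1) (wVbar s 0) (wquot F 0 n)
  (fun t => 'X *: tcoord (@c 0) t)
  (fun t => tcoord (@c 0) (tmap (fun q => wcls r.-1 (n + r.-1) (wrep q)) id t)) _ _ _).
- by move=> p x y; rewrite (tcoord_linear nr c0L) scalerDr !scalerA mulrC.
- refine (comp_linear (tcoord_linear erefl c0L) (tmap_linear jL (@id_linear _ _))).
move=> q l; rewrite (tmapE _ _ jL) // (tcoordE nr c0L).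
have qE : wrep q = (wrep q %/ 'X^r * 'X) * 'X^(r.-1).
  by rewrite -mulrA -exprS prednK // divpK ?wrep_dvd.
by rewrite [in RHS]qE (tcoord_wcls erefl c0L) scalerA mulrC.
Qed.
End GenericStructure.

(** * Equivalences *)

Section TensorMaps.
Variable A : comNzRingType.

Lemma tmap_comp (M N M' N' M'' N'' : lmodType A) (f : M -> M') (g : N -> N')
    (f' : M' -> M'') (g' : N' -> N'') : linear f -> linear g -> linear f' -> linear g' ->
  forall t, tmap f' g' (tmap f g t) = tmap (f' \o f) (g' \o g) t.
Proof.
move=> fL gL f'L g'L; apply: tensor_linear_ext.
- exact: comp_linear (tmap_linear f'L g'L) (tmap_linear fL gL).
- exact: tmap_linear (comp_linear f'L fL) (comp_linear g'L gL).
by move=> u v; rewrite !tmapE //; apply: comp_linear.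
Qed.

Lemma tmap_id (M N : lmodType A) (t : tensor M N) : tmap id id t = t.
Proof.
move: t; apply: tensor_linear_ext => [||u v].
- exact: tmap_linear.
- exact: id_linear.
by rewrite tmapE.
Qed.
End TensorMaps.

Section Theta.
Variables (F : fieldType) (r m : nat) (E : lmodType {poly F}).
Variables (nabla : linmap E E) (nu : nat -> {poly F}) (V : filtration r E).
Variable s : factorized_data m V.
Hypotheses (r1 : (1 < r)%N) (m0 : (0 < m)%N) (sP : is_factorized_on nabla nu s).
Let n := nR r m.
Let r0 : (0 < r)%N. Proof. exact: ltnW. Qed.

Lemma factorized_zcoord k : (k < r)%N -> exists c : Vbar m V k -> wquot F 0 n, zcoord c.
Proof.
move=> kr; have [_ [c [_ cP _]]] := factorized_frame r1 sP.
by exists (c k); apply: (frame_zcoord sP cP).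
Qed.

Lemma thetaP k j : (k < r)%N -> forall xi (eta : Vdual m V k),
  vartheta s k j xi eta = eta (theta s k j xi).
Proof.
by move=> kr xi eta; have [c cP] := factorized_zcoord kr; apply: (bidual_xget r0 m0 cP).
Qed.

(* By the symmetry of the pairings, theta_k and kappa_k are the transposes of
   theta_j and kappa_j. *)
Lemma theta_trN k j : (k + j).+1 = r -> forall xi,
  theta s k j (trN s xi) = Nop s k (theta s k j xi).
Proof.
move=> kj xi; have jk : (j + k).+1 = r by rewrite addnC.
have kr : (k < r)%N by rewrite -kj ltnS leq_addr.
have jr : (j < r)%N by rewrite -kj ltnS leq_addl.
have [_ [vS _ _ _] [kS _ _] _ _] := sP.
have [c cP] := factorized_zcoord kr; apply: (dual_separated r0 m0 cP) => eta.
(* The rewriting follows xi(N_j theta_j eta) = varkappa_j(theta_j eta, theta_k xi) =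
   varkappa_k(theta_k xi, theta_j eta) = eta(N_k theta_k xi). *)
rewrite -thetaP // (vS k j) // thetaP // /trN homcompE (NopE s jk) -thetaP // (vS j k) //.
rewrite thetaP // (kS j k) // -thetaP // (vS j k) // thetaP //.
by rewrite (NopE s kj).
Qed.
End Theta.

Section Equivalences.
Variables (F : fieldType) (r m : nat) (E : lmodType {poly F}).
Variables (nabla : linmap E E) (nu : nat -> {poly F}) (V : filtration r E).
Variables s s' : factorized_data m V.
Hypotheses (r1 : (1 < r)%N) (m0 : (0 < m)%N).
Hypotheses (sP : is_factorized_on nabla nu s) (s'P : is_factorized_on nabla nu s').
Let n := nR r m.
Let r0 : (0 < r)%N. Proof. exact: ltnW. Qed.
Let rr : (r.-1 < r)%N. Proof. by rewrite prednK. Qed.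

(** As N_k = N'_k, the identity of Vbar_k is F[w]-linear from one structure to the other and serves
    as sigma_k. *)
Lemma correspondence_equiv : factorized_equiv_on s s' ->
  generic_equiv_on (correspondence_on s) (correspondence_on s').
Proof.
case=> eqN _.
have eqA k f (v : Vbar m V k) : (k < r)%N -> polyact (Nop s k) f v = polyact (Nop s' k) f v.
  by move=> kr; apply: (polyact_comm (f := id)) => // u; apply: eqN.
have idL k : (k < r)%N -> linear (id : wVbar s k -> wVbar s' k).
  by move=> kr p u v; congr (_ + _); apply: eqA.
have [_ [c [_ cP _]]] := factorized_frame r1 sP.
have [_ [c' [_ c'P _]]] := factorized_frame r1 s'P.
have gL := corr_gphir_linear r1 m0 cP; have gL' := corr_gphir_linear r1 m0 c'P.
have idT := tmap_linear (@id_linear _ (wquot F r (m * r).+1)) (idL 0 r0).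
have gE : (fun t => @gphir _ _ _ _ _ (correspondence_on s) t : wVbar s' r.-1) =1
    (fun t => @gphir _ _ _ _ _ (correspondence_on s')
      (@tmap _ (wquot F r (m * r).+1) (wVbar s 0) (wquot F r (m * r).+1) (wVbar s' 0) id id t)).
  apply: (@tensor_linear_ext _ (wquot F r (m * r).+1) (wVbar s 0) (wVbar s' r.-1)).
  - exact: comp_linear (idL _ rr) gL.
  - exact: comp_linear gL' idT.
  move=> q v; rewrite (tmapE _ _ (@id_linear _ _) (idL 0 r0)).
  rewrite -[q]wrepK -(divpK (wrep_dvd q)) (corr_gphirE r1 m0 cP).
  by rewrite (corr_gphirE r1 m0 c'P) eqA.
have gpiE k (kr : (k < r)%N) (v : subm (fil V k)) :
    gpi1 (correspondence_on s) v = gpi1 (correspondence_on s') v :> Vbar m V k.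
  by rewrite [LHS](corr_gpi1 sP) // [RHS](corr_gpi1 s'P).
have idB k : bijective (id : wVbar s k -> wVbar s' k) by exists id.
exists (fun k => (id : wVbar s k -> wVbar s' k)); split; [|exact: gpiE | | exact: gE].
- by move=> k kr; split; [exact: idL | exact: idB].
- exact: (fun k _ l => erefl (Defs.iota l)).
Qed.

(** Compatibility with π_k makes sigma_k fix the class of every vector of V_k, so sigma_k is the
    identity; its linearity with respect to w then says N_k = N'_k. *)
Lemma equiv_correspondence : generic_equiv_on (correspondence_on s) (correspondence_on s') ->
  factorized_equiv_on s s'.
Proof.
case=> sigma [sL spi _ _].
have [_ [_ thB thI thR] [_ kaI kaR] _ _] := sP.
have [_ [_ thB' thI' thR'] [_ kaI' kaR'] _ _] := s'P.
have sid k (v : Vbar m V k) : (k < r)%N -> sigma k v = v.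
  move=> kr; have [w wV ->] := Vcls_surj v.
  have := spi k kr (tosubm (fil V k) w).
  by rewrite (corr_gpi1 sP) // (corr_gpi1 s'P) // val_tosubm.
have eqN k : (k < r)%N -> Nop s k =1 Nop s' k.
  move=> kr v; have [/linear_mapZ/(_ 'X v) + _] := sL k kr; rewrite !sid //.
  by rewrite [X in X = _]polyactX [X in _ = X]polyactX.
split=> //.
(* theta_k^-1 theta'_k for k = r - 1 - j; the default is not taken when j < r, theta_k being
   onto. *)
pose f j (xi : Vdual m V j) : Vdual m V j :=
  xget 0 [set eta | theta s (r - j.+1) j eta = theta s' (r - j.+1) j xi]%classic.
have fE k j : (k + j).+1 = r -> forall xi, theta s k j (f j xi) = theta s' k j xi.
  move=> kj xi; have [d _ dc] := thB k j kj; rewrite /f.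
  have -> : (r - j.+1)%N = k by rewrite -kj subSS addnK.
  by case: xgetP => [//|/(_ (d (theta s' k j xi)))[]] /=.
have jk j : (j < r)%N -> (r - j.+1 + j).+1 = r by move=> jr; rewrite -addnS subnK.
have fL j : (j < r)%N -> linear (f j).
  move=> /jk/[dup] /thB/bij_inj thI0 /fE h p x y; apply: thI0.
  by rewrite [RHS](homP (theta s _ _)) !h (homP (theta s' _ _)).
pose vs j := homof (f j).
have vsE k j : (k + j).+1 = r -> forall xi, theta s k j (vs j xi) = theta s' k j xi.
  move=> kj xi; have jr : (j < r)%N by rewrite -kj ltnS leq_addl.
  by rewrite /vs (homofE (fL j jr)) fE.
exists vs; split.
- move=> j jr; have kj := jk j jr; split.
    have [d cd dc] := thB _ _ kj; have [d' cd' dc'] := thB' _ _ kj.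
    exists (d' \o theta s (r - j.+1) j) => [xi|eta] /=; first by rewrite vsE.
    by apply: (bij_inj (thB _ _ kj)); rewrite vsE // dc'.
  move=> xi; apply: (bij_inj (thB _ _ kj)).
  rewrite (theta_trN r1 m0 sP) // !vsE // eqN ?leq_subLR ?ltn_subrL //.
  have -> : trN s xi = trN s' xi.
    by apply: hom_ext => v; rewrite /trN [LHS]homcompE [RHS]homcompE eqN.
  by rewrite (theta_trN r1 m0 s'P).
- move=> k j kj; split=> [xi|v]; first by rewrite vsE.
  (* After applying the injective theta_k: theta_k vs_j kappa'_k = theta'_k kappa'_k = N'_k = N_k =
     theta_k kappa_k. *)
  apply: (bij_inj (thB _ _ kj)); rewrite vsE // -(NopE s kj) -(NopE s' kj).
  by rewrite eqN // -kj ltnS leq_addr.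
- move=> j jr xi; pose k := (r - j.+2)%N.
  have kj : (k + j).+2 = r by rewrite /k -!addnS subnK.
  have kj' : (k + j.+1).+1 = r by rewrite addnS.
  have kj'' : (k.+1 + j).+1 = r by rewrite addSn.
  by apply: (bij_inj (thB _ _ kj')); rewrite vsE // thI // vsE // thI'.
have kj : (r.-1 + 0).+1 = r by rewrite addn0 prednK.
have kj' : (0 + r.-1).+1 = r by rewrite add0n prednK.
move=> t; apply: (bij_inj (thB _ _ kj)); rewrite vsE // thR thR'; congr iotar.
rewrite tmap_comp //; try exact: homP.
by congr tmap; apply: funext => xi /=; rewrite vsE.
Qed.
End Equivalences.

(** * Factorized structures in coordinates *)

Section DualMaps.
Variables (F : fieldType) (r m : nat) (E : lmodType {poly F}).
Variables (nabla : linmap E E) (V : filtration r E).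
Hypotheses (r0 : (0 < r)%N) (m0 : (0 < m)%N) (VP : is_filtration nabla V).
Local Notation iota := (@Defs.iota F r m E V _).

Lemma iotaWE j (xi : Vdual m V j) v : (j.+1 < r)%N -> iotaW xi v = xi (iota v).
Proof.
move=> jr; rewrite /iotaW homofE //.
exact: comp_linear (homP xi) (iota_linear (m := m) VP jr).
Qed.

Lemma iotar_tens_linear p : linear (fun v : Vbar m V 0 => iotar (p ⊗ v)).
Proof. by move=> a u v; rewrite tens_linr (iotar_linear r0 m0 VP). Qed.

Lemma dual_iotarE p (xi : Vdual m V r.-1) v :
  (homof (fun v => xi (iotar (p ⊗ v))) : Vdual m V 0) v = xi (iotar (p ⊗ v)).
Proof.
by rewrite homofE //; apply: comp_linear (homP xi) (iotar_tens_linear p).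
Qed.

Lemma iotarW_bilinear : bilinear_map (fun (p : wquot F 1 m.+1) (xi : Vdual m V r.-1) =>
  homof (fun v => xi (iotar (p ⊗ v))) : Vdual m V 0).
Proof.
split=> [xi a p p'|p a xi xi']; apply: hom_ext => v.
  rewrite [LHS]dual_iotarE tens_linl (iotar_linear r0 m0 VP) (homP xi).
  by congr (_ *: _ + _); rewrite dual_iotarE.
by rewrite [LHS]dual_iotarE /=; congr (_ *: _ + _); rewrite dual_iotarE.
Qed.

Lemma iotarW_linear : linear (@iotarW F r m E V).
Proof. exact/tlift_linear/iotarW_bilinear. Qed.

Lemma iotarWE p (xi : Vdual m V r.-1) v : iotarW (p ⊗ xi) v = xi (iotar (p ⊗ v)).
Proof. by rewrite /iotarW (tliftE _ _ iotarW_bilinear) dual_iotarE. Qed.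
End DualMaps.

Section Model.
Variables (F : fieldType) (r m : nat) (E : lmodType {poly F}).
Variables (nabla : linmap E E) (nu : nat -> {poly F}) (V : filtration r E).
Hypotheses (r1 : (1 < r)%N) (m0 : (0 < m)%N) (VP : is_filtration nabla V).
Let n := nR r m.
Let r0 : (0 < r)%N. Proof. exact: ltnW. Qed.
Let rr : (r.-1 < r)%N. Proof. by rewrite prednK. Qed.
Local Notation R := (wquot F 0 n).
Local Notation iota := (@Defs.iota F r m E V _).
Local Notation zw := (zw F r).

Variable c : forall k, Vbar m V k -> R.
Hypothesis cP : forall k, (k < r)%N -> zcoord (@c k).
Hypothesis c_iota : forall k, (k.+1 < r)%N -> forall v, c (iota v) = 'X *: @c k.+1 v.
Hypothesis c_iotar : forall v, @c r.-1 (iotar (wcls 1 m.+1 'X ⊗ v)) = 'X *: @c 0 v.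
Hypothesis c_nabla : forall k, (k < r)%N -> {in fil V k, forall v,
  c (Vcls m V k (nabla v)) = exponent r m nu k *: c (Vcls m V k v)}.

(* With W_k identified with F[w]/(w^n) by the trace pairing, theta is the identity
   and kappa is multiplication by w. *)
Definition model : factorized_data m V := FactorizedData
  (fun k j => homof (fun xi : Vdual m V j => homof (fun eta : Vdual m V k =>
     tpair (dcoord (@c j) xi) (dcoord (@c k) eta))))
  (fun k j => homof (fun v => homof (fun v' => tpair ('X *: @c k v) (@c j v')))).

Lemma homof_tpair (W W' : lmodType {poly F}) (f : W -> R) (f' : W' -> R) :
  (forall p x y, f (p *: x + y) = zw p *: f x + f y) ->
  (forall p x y, f' (p *: x + y) = zw p *: f' x + f' y) ->
  forall w w',
    homof (fun w => homof (fun w' => tpair (f w) (f' w'))) w w' = tpair (f w) (f' w').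
Proof.
move=> fL f'L; have h w : linear (fun w' => tpair (f w) (f' w')).
  by move=> p x y; rewrite f'L tpairPr.
have hL : linear (fun w => homof (fun w' => tpair (f w) (f' w'))).
  by move=> p x y; apply: hom_ext => w' /=; rewrite !(homofE (h _)) fL tpairPl.
by move=> w w'; rewrite (homofE hL) (homofE (h w)).
Qed.

Lemma model_vartheta k j : (k < r)%N -> (j < r)%N -> forall xi eta,
  vartheta model k j xi eta = tpair (dcoord (@c j) xi) (dcoord (@c k) eta).
Proof.
move=> kr jr; apply: homof_tpair.
- exact: (dcoord_zcoord r0 m0 (cP jr)).1.
- exact: (dcoord_zcoord r0 m0 (cP kr)).1.
Qed.

Lemma model_varkappa k j : (k < r)%N -> (j < r)%N -> forall v v',
  varkappa model k j v v' = tpair ('X *: @c k v) (@c j v').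
Proof.
move=> kr jr v v'; apply: (homof_tpair (f := fun v => 'X *: @c k v)); last exact: (cP jr).1.
by move=> p x y; rewrite (cP kr).1 scalerDr !scalerA mulrC.
Qed.

Lemma coord_theta k j : (k < r)%N -> (j < r)%N -> forall xi,
  c (theta model k j xi) = dcoord (@c j) xi.
Proof.
move=> kr jr xi; apply: (tpair_inj r0 m0) => y; rewrite !(tpairC r0 m0 _ y).
rewrite -(dcoord_of r0 m0 (cP kr) y) -(dcoordE r0 m0 (cP kr)).
rewrite -(bidual_xget r0 m0 (cP kr) (vartheta model k j)) model_vartheta //.
exact: tpairC.
Qed.

Lemma dcoord_varkappa k j : (k < r)%N -> (j < r)%N -> forall v,
  dcoord (@c j) (varkappa model k j v) = 'X *: c v.
Proof.
move=> kr jr v; apply: (dcoord_uniq r0 m0 (cP jr)) => v'; exact: model_varkappa.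
Qed.

Lemma coord_Nop k : (k < r)%N -> forall v, c (Nop model k v) = 'X *: c v.
Proof.
move=> kr v; have jr : (r - k.+1 < r)%N by rewrite ltn_subrL r0.
by rewrite /Nop homcompE coord_theta // dcoord_varkappa.
Qed.

(** Multiplication by w is self-adjoint for the trace pairing, so the transposed canonical maps are
    again multiplication by w, and theta and kappa commute with them. *)
Lemma dcoord_iotaW j : (j.+1 < r)%N -> forall xi,
  dcoord (@c j.+1) (iotaW xi) = 'X *: dcoord (@c j) xi.
Proof.
move=> jr xi; apply: (dcoord_uniq r0 m0 (cP jr)) => v.
by rewrite (iotaWE VP) // (dcoordE r0 m0 (cP (ltnW jr))) c_iota // tpairZ.
Qed.

Lemma coord_iotar p v :
  @c r.-1 (iotar (p ⊗ v)) = zw (wrep p %/ 'X) *: ('X *: @c 0 v).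
Proof.
rewrite -c_iotar -(zcoordZ (cP rr)) -(linear_mapZ (iotar_linear r0 m0 VP)) -tensZl.
by congr (c (iotar (_ ⊗ _))); apply: wclsE_div.
Qed.

Lemma dcoord_iotarW p xi :
  dcoord (@c 0) (iotarW (p ⊗ xi)) = zw (wrep p %/ 'X) *: ('X *: dcoord (@c r.-1) xi).
Proof.
apply: (dcoord_uniq r0 m0 (cP r0)) => v.
by rewrite (iotarWE r0 m0 VP) (dcoordE r0 m0 (cP rr)) coord_iotar !tpairZ // !scalerA mulrC.
Qed.

Lemma coord_polyact k : (k < r)%N -> forall f v, c (polyact (Nop model k) f v) = f *: @c k v.
Proof.
move=> kr f v; elim/poly_ind: f v => [|f a IH] v.
  by rewrite -(@polyC0 F) polyactC polyC0 !scale0r (zcoord0 (cP kr)).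
rewrite polyactDl polyactMX polyactC (zcoordD (cP kr)) IH coord_Nop //.
by rewrite (zcoordZ (cP kr)) /= comp_polyC scalerDl !scalerA.
Qed.

Lemma model_frame : @frame F r m (wVbar model) (fun k => iota)
  (fun v : wVbar model 0 => iotar (wcls 1 m.+1 'X ⊗ (v : Vbar m V 0)) : wVbar model r.-1) c.
Proof.
split; [|exact: c_iota|exact: c_iotar].
move=> k kr; have [cL cB] := cP kr; split; last exact: cB.
move=> p u v; rewrite -(coord_polyact kr p u).
exact: zcoordD (cP kr) (polyact (Nop model k) p u) v.
Qed.

Lemma model_theta_bij k j : (k < r)%N -> (j < r)%N -> bijective (theta model k j).
Proof.
move=> kr jr; have [d cd dc] := (cP kr).2.
apply: (eq_bij (f := d \o dcoord (@c j))) => [|xi].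
  by apply: bij_comp (dcoord_zcoord r0 m0 (cP jr)).2; exists (@c k).
by rewrite /= -(coord_theta kr jr) cd.
Qed.

Lemma model_theta_iotaW k j : (k.+1 < r)%N -> (j.+1 < r)%N -> forall xi,
  theta model k j.+1 (iotaW xi) = iota (theta model k.+1 j xi).
Proof.
move=> kr jr xi; have kr' := ltnW kr; have jr' := ltnW jr.
apply: (bij_inj (cP kr').2).
by rewrite coord_theta // c_iota // dcoord_iotaW // coord_theta.
Qed.

Let tmapL (W W' : lmodType {poly F}) (h : linmap W W') :
  linear (tmap (@id (wquot F 1 m.+1)) h).
Proof. by apply: tmap_linear => //; apply: homP. Qed.

Lemma model_theta_iotarW t :
  theta model r.-1 0 (iotarW t) = iotar (tmap id (theta model 0 r.-1) t).
Proof.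
move: t; apply: tensor_linear_ext.
- exact: comp_linear (homP _) (iotarW_linear r0 m0 VP).
- exact: comp_linear (iotar_linear r0 m0 VP) (tmapL _).
move=> p xi; rewrite tmapE //; last exact: homP.
apply: (bij_inj (cP rr).2).
by rewrite coord_theta // dcoord_iotarW coord_iotar coord_theta.
Qed.

Lemma model_varkappa_iota k j : (k.+1 < r)%N -> (j.+1 < r)%N -> forall v,
  varkappa model k j.+1 (iota v) = iotaW (varkappa model k.+1 j v).
Proof.
move=> kr jr v; have kr' := ltnW kr; have jr' := ltnW jr.
apply: (bij_inj (dcoord_zcoord r0 m0 (cP jr)).2).
by rewrite dcoord_varkappa // dcoord_iotaW // dcoord_varkappa // c_iota.
Qed.

Lemma model_varkappa_iotar t :
  varkappa model r.-1 0 (iotar t) = iotarW (tmap id (varkappa model 0 r.-1) t).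
Proof.
move: t; apply: tensor_linear_ext.
- exact: comp_linear (homP _) (iotar_linear r0 m0 VP).
- exact: comp_linear (iotarW_linear r0 m0 VP) (tmapL _).
move=> p v; rewrite tmapE //; last exact: homP.
apply: (bij_inj (dcoord_zcoord r0 m0 (cP r0)).2).
rewrite dcoord_varkappa // dcoord_iotarW coord_iotar dcoord_varkappa // !scalerA.
by rewrite ['X * _]mulrC.
Qed.

Lemma model_twist : exists2 psi, @is_twist F r m (wVbar model) psi (fun k => iota) &
  forall (p : {poly F}) (v : Vbar m V 0), 'X %| p ->
    chain psi (iotar (wcls 1 m.+1 p ⊗ v) : wVbar model r.-1) =
    wcls r.-1 (n + r.-1) (zw p) ⊗ (v : wVbar model 0).
Proof.
have [cB _ _] := model_frame; have [c0L c0B] := cB 0 r0.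
have [psi psiP chE] := frame_twist model_frame; exists psi => [|p v Xp]; first exact: psiP.
apply: (bij_inj (tcoord_bij (erefl (n + r.-1)%N) c0L c0B)).
rewrite (chE _ rr).2 coord_iotar.
have /dvdpP[f pE] := Xp.
have -> : zw p = zw f * 'X * 'X^(r.-1).
  by rewrite pE /= comp_polyM comp_polyX -mulrA -exprS prednK.
rewrite (tcoord_wcls erefl c0L) scalerA.
(* The representative of p is known modulo z^(m+1), hence its quotient by z modulo z^m = w^(mr).
   With the extra factor w the discrepancy is a multiple of w^(mr+1), which acts as zero because n
   <= mr + 1. *)
have [a aE] : exists a, wrep (wcls 1 m.+1 p) %/ 'X = f + a * 'X^m.
  have /dvdpP[a aE] := wrep_wcls m.+1 (Xp : 'X^1 %| p); exists a.
  have -> : wrep (wcls 1 m.+1 p) = (f + a * 'X^m) * 'X.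
    by rewrite mulrDl -pE -mulrA -exprSr -aE addrC subrK.
  by rewrite mulpK // polyX_eq0.
apply: wquot_scale_eq.
rewrite aE /= comp_polyD comp_polyM comp_Xn_poly mulrDl addrC addKr -mulrA.
rewrite -exprM -exprSr dvdp_mull // dvdp_exp2l // /nR ltnS mulnC.
by rewrite leq_subLR leq_addl.
Qed.

Lemma model_factorized : is_factorized_on nabla nu model.
Proof.
have lt1 k j : (k + j).+1 = r -> (k < r)%N by move=> <-; rewrite ltnS leq_addr.
have lt2 k j : (k + j).+1 = r -> (j < r)%N by move=> <-; rewrite ltnS leq_addl.
have lt3 k j : (k + j).+2 = r -> (k.+1 < r)%N by rewrite -addSn; apply: lt1.
have lt4 k j : (k + j).+2 = r -> (j.+1 < r)%N by rewrite -addnS; apply: lt2.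
split; [exact: VP | split | split | | exact: model_twist].
- move=> k j e v v'; have kr := lt1 _ _ e; have jr := lt2 _ _ e.
  by rewrite !model_vartheta // tpairC.
- by move=> k j e; apply: model_theta_bij; [exact: lt1 e | exact: lt2 e].
- by move=> k j e; apply: model_theta_iotaW; [exact: lt3 e | exact: lt4 e].
- exact: model_theta_iotarW.
- move=> k j e v v'; have kr := lt1 _ _ e; have jr := lt2 _ _ e.
  by rewrite !model_varkappa // tpairZ // tpairC.
- by move=> k j e; apply: model_varkappa_iota; [exact: lt3 e | exact: lt4 e].
- exact: model_varkappa_iotar.
move=> k kr; have [d cd dc] := (cP kr).2; have cI := bij_inj (cP kr).2.
have c0 := zcoord0 (cP kr).
split.
- move=> v; apply: cI.
  by rewrite -polyactXn coord_polyact // (zcoordZ (cP kr)) /= comp_polyX.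
- move=> v; apply: cI; rewrite -polyactXn coord_polyact // c0.
  exact/wquot_ann/dvdp_mulr.
(* Faithfulness is tested on the vector of coordinate 1. *)
- move=> f /(_ (d (wcls 0 n 1)))/(f_equal (@c k)).
  rewrite coord_polyact // dc c0 scale_wcls0 mulr1 => /wcls_eq0; apply; exact: dvdX0.
- by move=> v vV; apply: cI; rewrite c_nabla // coord_polyact.
Qed.
End Model.

(** * From generic to factorized structures *)

Lemma btens_linearl (A B : comNzRingType) (h : {rmorphism A -> B}) (M : lmodType A)
    (Q : lmodType B) p (u v : M) (q : Q) :
  btens h (p *: u + v) q = h p *: btens h u q + btens h v q.
Proof.
rewrite /btens tens_linl -tensZr; congr (_ + _).
exact: esym (btensor_scaleE h (h p) u q).
Qed.

Section Generic.
Variables (F : fieldType) (r m : nat) (E : lmodType {poly F}).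
Variables (nabla : linmap E E) (nu : nat -> {poly F}) (V : filtration r E).
Variable g : generic_data m V.
Hypotheses (r1 : (1 < r)%N) (m0 : (0 < m)%N) (gP : is_generic_on nabla nu g).
Let n := nR r m.
Let r0 : (0 < r)%N. Proof. exact: ltnW. Qed.
Let rr : (r.-1 < r)%N. Proof. by rewrite prednK. Qed.
Local Notation R := (wquot F 0 n).
Local Notation iota := (@Defs.iota F r m E V _).
Local Notation zw := (zw F r).
Local Notation gphirg := (@gphir _ _ _ _ _ g).

Let VP : is_filtration nabla V. Proof. by case: gP. Qed.
Let nr : (m * r).+1 = (n + r)%N.
Proof. by rewrite /n /nR addSn subnK // leq_pmull. Qed.

(** π_k on V_k, made total on E so that one vector can be followed through several V_k; outside V_k
    the value is junk. *)
Definition generic_map k (v : E) : gL g k := gpi1 g (tosubm (fil V k) v).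
Local Notation h := generic_map.

Lemma generic_map_linear k : (k < r)%N -> forall p v v', v \in fil V k -> v' \in fil V k ->
  h k (p *: v + v') = zw p *: h k v + h k v'.
Proof.
move=> kr p v v' vV v'V; have [_ /(_ k kr)[gL _ _ _] _ _ _] := gP.
rewrite /h /gpi1 -gL -btens_linearl; congr (gpi g (btens zw _ _)).
by apply: val_inj; rewrite subm_valP !val_tosubm ?rpredD ?rpredZ.
Qed.

Lemma generic_map_surj k (l : gL g k) : (k < r)%N -> exists2 v, v \in fil V k & h k v = l.
Proof.
move=> kr; have [_ /(_ k kr)[_ _ /(_ l)[v <-] _] _ _ _] := gP.
exists (val v); first exact: valP.
by rewrite /h; congr gpi1; apply: val_inj; rewrite val_tosubm //; apply: valP.
Qed.

Lemma generic_map_nabla k v : (k < r)%N -> v \in fil V k ->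
  h k (nabla v) = exponent r m nu k *: h k v.
Proof.
move=> kr vV; have [_ /(_ k kr)[_ _ _ gN] _ _ _] := gP.
have [_ _ _ _ nV] := VP; have fV := nV k kr.
rewrite -gN (ext_mapE (homP nabla)) //; congr (gpi g (btens zw _ _)).
by apply: val_inj; rewrite val_subm_map // !val_tosubm ?fV.
Qed.

Lemma gphi_map k v : (k.+1 < r)%N -> v \in fil V k.+1 -> gphi (h k.+1 v) = h k v.
Proof.
move=> kr vV; have [_ _ /(_ k kr)[_ _ gE] _ _] := gP.
have fV w : w \in fil V k.+1 -> w \in fil V k.
  by apply: (fil_mono VP); rewrite leqnSn ltnW.
rewrite gE (ext_mapE (@id_linear _ E)) //; congr (gpi g (btens zw _ _)).
by apply: val_inj; rewrite val_subm_map // !val_tosubm ?fV.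
Qed.

Lemma gphir_map v : gphirg (wcls r (m * r).+1 'X^r ⊗ h 0 v) = h r.-1 ('X *: v).
Proof.
have [_ _ _ [_ _ gE] _] := gP; have [V0 _ _ _ _] := VP.
have XL : linear ( *:%R 'X : E -> E) by move=> a u w; rewrite scalerDr !scalerA mulrC.
have XV w : w \in fil V 0 -> 'X *: w \in fil V r.-1 by move=> _; apply: (fil_pred VP).
have -> : 'X^r = zw 'X by rewrite /= comp_polyX.
rewrite gE // (ext_mapE XL XV); congr (gpi g (btens zw _ _)).
by apply: val_inj; rewrite (val_subm_map XV) !val_tosubm ?XV.
Qed.

(** Freeness of L_0 supplies the first coordinate, and the condition on the composite of the twists,
    applied to w^r ⊗ l, is what [twist_frame] asks of φ_r. *)
Lemma generic_frame : exists c, @frame F r m (gL g) (@gphi _ _ _ _ _ g)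
  (fun l => gphirg (wcls r (m * r).+1 'X^r ⊗ l)) c.
Proof.
have [_ /(_ 0 r0)[_ [u uL uB] _ _] _ _ [psi psiP psiC]] := gP.
have [c0 [c0L c0B _]] := inv_linear uL uB.
pose phir l := gphirg (wcls r (m * r).+1 'X^r ⊗ l).
have phirE l : chain psi (phir l) = wcls r.-1 (n + r.-1) 'X^r ⊗ l.
  rewrite psiC tmapE //; last first.
    by apply: wquot_sub_linear; rewrite ?leq_pred // nr leq_add2l leq_pred.
  congr (_ ⊗ _); apply/wcls_eq.
  - by apply: dvdp_trans (wrep_dvd _); rewrite dvdp_exp2l ?leq_pred.
  - by rewrite dvdp_exp2l ?leq_pred.
  by apply: dvdp_trans (wrep_wcls _ _); rewrite // dvdp_exp2l // nr leq_add2l leq_pred.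
by have [c cP _] := twist_frame r0 c0L c0B psiP phirE; exists c.
Qed.

Variable c : forall k, gL g k -> R.
Hypothesis cP : @frame F r m (gL g) (@gphi _ _ _ _ _ g)
  (fun l => gphirg (wcls r (m * r).+1 'X^r ⊗ l)) c.
Local Notation C k v := (@c k (h k v)).

Lemma coordC_linear k : (k < r)%N -> forall p v v', v \in fil V k -> v' \in fil V k ->
  C k (p *: v + v') = zw p *: C k v + C k v'.
Proof.
move=> kr p v v' vV v'V; have [cB _ _] := cP.
by rewrite generic_map_linear // (cB k kr).1.
Qed.

Lemma coordC0 k : (k < r)%N -> C k 0 = 0.
Proof.
move=> kr; have := coordC_linear kr (-1) (rpred0 _) (rpred0 (fil V k)).
by rewrite scaler0 addr0 rmorphN1 scaleN1r addNr.
Qed.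

Lemma coordCZ k p v : (k < r)%N -> v \in fil V k -> C k (p *: v) = zw p *: C k v.
Proof.
by move=> kr vV; have := coordC_linear kr p vV (rpred0 _); rewrite coordC0 // !addr0.
Qed.

Lemma coordC_S k v : (k.+1 < r)%N -> v \in fil V k.+1 -> C k v = 'X *: C k.+1 v.
Proof. by move=> kr vV; have [_ cphi _] := cP; rewrite -gphi_map // cphi. Qed.

Lemma coordC_r v : C r.-1 ('X *: v) = 'X *: C 0 v.
Proof. by have [_ _ cR] := cP; rewrite -gphir_map cR. Qed.

Lemma fil_rP v : v \in fil V r -> exists w, v = 'X *: w.
Proof. by have [_ _ Vr _ _] := VP; rewrite Vr => /scaledP[w _ ->]; exists w. Qed.

Lemma coordC_fil k v : (k < r)%N -> v \in fil V k.+1 -> exists x, C k v = 'X *: x.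
Proof.
move=> kr; have [k'r vV|] := ltnP k.+1 r; first by exists (C k.+1 v); apply: coordC_S.
move=> rk; have kE : k.+1 = r by apply/eqP; rewrite eqn_leq kr rk.
have -> : k = r.-1 by rewrite -kE.
by rewrite prednK // => /fil_rP[w ->]; rewrite coordC_r; exists (C 0 w).
Qed.

(** Write v = a e modulo V_(k+1), with e a generator of the quotient. If a were nonzero, e would map
    into w L_k, as V_(k+1) does by [coordC_fil]; then all of V_k would, against surjectivity onto
    L_k. *)
Lemma fil_coordC k v x : (k < r)%N -> v \in fil V k -> C k v = 'X *: x -> v \in fil V k.+1.
Proof.
move=> kr vV vx; have [e eV eP] := fil_gen VP kr; have [a aP] := eP v vV.
have [a0|a0] := eqVneq a 0; first by rewrite a0 polyC0 scale0r subr0 in aP.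
have Vs : {subset fil V k.+1 <= fil V k} by apply: (fil_mono VP); rewrite leqnSn.
have [y ey] : exists y, C k e = 'X *: y.
  have [w wP] := coordC_fil kr aP.
  have eE : e = (a^-1)%:P *: (-1 *: (v - a%:P *: e) + v).
    by rewrite scaleN1r opprB subrK scalerA -polyCM mulVf // scale1r.
  exists ((a^-1)%:P *: (x - w)); rewrite eE coordCZ //; last first.
    by rewrite rpredD // rpredZ // Vs.
  rewrite (coordC_linear kr (-1) (Vs _ aP) vV) rmorphN1 scaleN1r vx wP /= comp_polyC.
  by rewrite !scalerA mulrC -scalerA scalerBr addrC.
have [cB _ _] := cP; have [d _ dc] := (cB k kr).2.
have [u uV uE] := generic_map_surj (d (wcls 0 n 1)) kr.
have [b bP] := eP u uV; have [w wP] := coordC_fil kr bP.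
have [t] : exists t : R, wcls 0 n 1 = 'X *: t.
  exists (w + b%:P *: y).
  rewrite -[LHS]dc -uE -{1}[u](subrK (b%:P *: e)) addrC.
  rewrite (coordC_linear kr b%:P eV (Vs _ bP)).
  by rewrite ey wP /= comp_polyC scalerDr !scalerA addrC mulrC.
(* The vector u has coordinate 1, which is not a multiple of w modulo w^n because n > 0. *)
rewrite -[t]wrepK scale_wcls0 => /(wcls_eq n (dvdX0 _) (dvdX0 _)) h1.
have : 'X %| (1 : {poly F}) - 'X * wrep t.
  by apply: dvdp_trans h1; rewrite /n /nR exprS dvdp_mulr.
by rewrite dvdp_subl ?dvdp_mulr // dvdp1 size_polyX.
Qed.

Lemma dvd_wrepX j (y : R) : (j < n)%N -> 'X^(j.+1) %| wrep ('X *: y) -> 'X^j %| wrep y.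
Proof.
move=> jn Xy; have : 'X^(j.+1) %| wrep ('X *: y) - 'X * wrep y.
  by apply: dvdp_trans (wrepZ _ _); rewrite dvdp_exp2l.
by rewrite dvdp_subr // exprS dvdp_mul2l // polyX_eq0.
Qed.

(* [V_(k + j)] for [k + j >= r] is [z^a V_b] with [k + j = a r + b]. *)
Lemma fil_coordC_exp j k v : (j <= n)%N -> (k < r)%N -> v \in fil V k ->
  'X^j %| wrep (C k v) ->
  exists a b y, [/\ (b < r)%N, (a * r + b)%N = (k + j)%N, y \in fil V b & v = 'X^a *: y].
Proof.
elim: j k v => [|j IH] k v jn kr vV Xj.
  by exists 0%N, k, v; rewrite addn0 expr0 scale1r.
have vV' : v \in fil V k.+1.
  apply: (@fil_coordC k v (wcls 0 n (wrep (C k v) %/ 'X)) kr vV).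
  rewrite scale_wcls0 mulrC divpK ?wrepK //.
  by apply: dvdp_trans Xj; rewrite exprS dvdp_mulr.
have [k'r|rk] := ltnP k.+1 r.
  have [|a [b [y [br e yV vy]]]] := IH k.+1 v (ltnW jn) k'r vV'.
    by rewrite coordC_S // in Xj; apply: dvd_wrepX Xj.
  by exists a, b, y; rewrite e addSnnS.
have kE : k.+1 = r by apply/eqP; rewrite eqn_leq kr rk.
have kE' : k = r.-1 by rewrite -kE.
(* Past V_(r-1) the filtration wraps around: v = z w with w in V_0, and passing from v to w costs
   one power of w in the coordinate, like every other step. *)
have [w wE] : exists w, v = 'X *: w by apply: fil_rP; rewrite -[X in fil V X]kE.
have [V0 _ _ _ _] := VP.
have [|a [b [y [br e yV vy]]]] := IH 0 w (ltnW jn) r0 (V0 w).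
  by rewrite wE kE' coordC_r in Xj; apply: dvd_wrepX Xj.
exists a.+1, b, y; split=> //; first by rewrite mulSn -addnA e -addSnnS kE.
by rewrite wE vy scalerA exprS.
Qed.

Lemma coordC_ker k v : (k < r)%N -> v \in fil V k ->
  C k v = 0 <-> v \in scaled 'X^(m.-1) (fil V k.+1).
Proof.
move=> kr vV; split=> [Cv|/scaledP[y yV ->]]; last first.
  have [x xE] := coordC_fil kr yV.
  have yV' : y \in fil V k by apply: (fil_mono VP) yV; rewrite leqnSn.
  rewrite coordCZ // xE scalerA; apply: wquot_ann.
  rewrite /= comp_Xn_poly -exprM -exprSr dvdp_mulr // dvdp_exp2l // /n /nR ltnS.
  by rewrite -subn1 mulnBr muln1 mulnC.
have Xn : 'X^n %| wrep (C k v) by rewrite Cv dvd_wrep0.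
have [a [b [y [br e yV ->]]]] := fil_coordC_exp (leqnn n) kr vV Xn.
(* Here k + n = (m - 1) r + (k + 1). If k + 1 < r, division with remainder gives a = m - 1 and b = k
   + 1; if k + 1 = r, it gives a = m, and z^m y = z^(m-1) (z y) with z y in V_r. *)
have {}e : (a * r + b = m.-1 * r + k.+1)%N.
  by rewrite e /n /nR addnS addnC addnS -subn1 mulnBl mul1n.
apply/scaledP; have [k'r|rk] := ltnP k.+1 r.
  have aE : a = m.-1.
    by have := f_equal (divn^~ r) e; rewrite !divnMDl // !divn_small // !addn0.
  by exists y; rewrite aE // in e *; move: e => /addnI <-.
have kE : k.+1 = r by apply/eqP; rewrite eqn_leq kr rk.
have aE : a = m.
  have := f_equal (divn^~ r) e; rewrite kE -mulSnr prednK // mulnK // divnMDl //.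
  by rewrite divn_small // addn0.
exists ('X *: y); last by rewrite aE -{1}(prednK m0) exprSr scalerA.
by apply: (fil_X VP).
Qed.

Definition coordV k (q : Vbar m V k) : R := C k (@rep _ _ (fil V k) _ q).

Lemma coordV_cls k v : (k < r)%N -> v \in fil V k -> coordV (Vcls m V k v) = C k v.
Proof.
move=> kr vV; have wV := rep_in (Vcls m V k v).
have dV := rep_cls (scaled 'X^(m.-1) (fil V k.+1)) vV.
have dV' : @rep _ _ (fil V k) _ (Vcls m V k v) - v \in fil V k by rewrite rpredB.
have := coordC_linear kr 1 dV' vV; rewrite rmorph1 !scale1r subrK /coordV => ->.
by rewrite (coordC_ker kr dV').2 // add0r.
Qed.

(** Injectivity is the kernel computation [coordC_ker]; surjectivity is the requirement that V_k
    alone, before tensoring with R, maps onto L_k. *)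
Lemma coordV_zcoord k : (k < r)%N -> zcoord (@coordV k).
Proof.
move=> kr; have CP p v v' : coordV (p *: v + v') = zw p *: coordV v + @coordV k v'.
  have [w wV ->] := Vcls_surj v; have [w' wV' ->] := Vcls_surj v'.
  by rewrite -Vcls_linear // !coordV_cls ?rpredD ?rpredZ // coordC_linear.
split=> //; have [cB _ _] := cP; have [d cd dc] := (cB k kr).2.
have hsurj x : exists q : Vbar m V k, coordV q = x.
  have [v vV vE] := generic_map_surj (d x) kr.
  by exists (Vcls m V k v); rewrite coordV_cls // vE dc.
have inj : injective (@coordV k).
  move=> q q' qq; apply/eqP; rewrite -subr_eq0; apply/eqP.
  have := CP (-1) q' q; rewrite scaleN1r rmorphN1 scaleN1r qq addNr addrC.
  have [v vV ->] := Vcls_surj (q - q'); rewrite coordV_cls // => /(coordC_ker kr vV) vS.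
  by apply/(cls_eq0 _ vV).
exists (fun x => xget 0 [set q | coordV q = x]%classic) => [q|x].
  by case: xgetP => [q' _ /inj //|/(_ q)[]].
by have [q qx] := hsurj x; case: xgetP => [//|/(_ q)[]].
Qed.

Lemma coordV_iota k v : (k.+1 < r)%N -> coordV (iota v) = 'X *: @coordV k.+1 v.
Proof.
move=> kr; have [w wV ->] := Vcls_surj v; have kr' := ltnW kr.
have wV' : w \in fil V k by apply: (fil_mono VP) wV; rewrite leqnSn ltnW.
by rewrite (iotaE m VP) // !coordV_cls // coordC_S.
Qed.

Lemma coordV_iotar v : @coordV r.-1 (iotar (wcls 1 m.+1 'X ⊗ v)) = 'X *: @coordV 0 v.
Proof.
have [w wV ->] := Vcls_surj v.
rewrite (iotarE r0 m0 VP) // !coordV_cls // ?coordC_r //.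
by apply: (fil_X VP); rewrite leq_pred.
Qed.

Lemma coordV_nabla k : (k < r)%N -> {in fil V k, forall v,
  coordV (Vcls m V k (nabla v)) = exponent r m nu k *: coordV (Vcls m V k v)}.
Proof.
move=> kr v vV; have [_ _ _ _ nV] := VP; have nvV := nV k kr v vV.
have [cB _ _] := cP.
by rewrite !coordV_cls // generic_map_nabla // (linear_mapZ (cB k kr).1).
Qed.
End Generic.

Lemma correspondence_surj (F : fieldType) (r m : nat) (E : lmodType {poly F})
    (nabla : linmap E E) (nu : nat -> {poly F}) (V : filtration r E) (g : generic_data m V) :
  (1 < r)%N -> (0 < m)%N -> is_generic_on nabla nu g ->
  exists2 s : factorized_data m V, is_factorized_on nabla nu s &
    generic_equiv_on (correspondence_on s) g.
Proof.
move=> r1 m0 gP; have r0 := ltnW r1; have VP : is_filtration nabla V by case: gP.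
have rr : (r.-1 < r)%N by rewrite prednK.
have [c cP] := generic_frame r1 m0 gP; have [cB cphi cR] := cP.
pose D := @coordV F r m E V g c.
have DP k (kr : (k < r)%N) : zcoord (D k) := coordV_zcoord r1 m0 gP cP kr.
have Di k (kr : (k.+1 < r)%N) v : D k (Defs.iota v) = 'X *: D k.+1 v :=
  coordV_iota r1 m0 gP cP v kr.
have Dr v : D r.-1 (iotar (wcls 1 m.+1 'X ⊗ v)) = 'X *: D 0 v :=
  coordV_iotar r1 m0 gP cP v.
have Dn k (kr : (k < r)%N) := coordV_nabla r1 m0 gP cP kr.
pose s := model D; have sP : is_factorized_on nabla nu s :=
  model_factorized r1 m0 VP DP Di Dr Dn.
have sF := model_frame r1 m0 DP Di Dr.
(* The map Vbar_k -> L_k induced by π_k. By definition [D k] is [c k] after [rho k], and w acts on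
   the model as multiplication by w through [D k]; so linearity and all compatibilities of [rho] are
   checked after applying [c k]. *)
pose rho k (q : wVbar s k) : gL g k := generic_map g k (@rep _ _ (fil V k) _ (q : Vbar m V k)).
have rhoE k q : @c k (rho k q) = D k q by [].
have rhoL k : (k < r)%N -> linear (rho k).
  move=> kr p x y; have [cL cb] := cB k kr; apply: (bij_inj cb).
  by rewrite cL !rhoE; have [/(_ k kr)[sL _] _ _] := sF; rewrite sL.
have gL' := corr_gphir_linear r1 m0 sF; have [_ _ _ [gphirL _ _] _] := gP.
have rhoT := tmap_linear (@id_linear _ (wquot F r (m * r).+1)) (rhoL 0 r0).
have gE : (fun t => rho r.-1 (@gphir _ _ _ _ _ (correspondence_on s) t)) =1
    (fun t => @gphir _ _ _ _ _ g (@tmap _ (wquot F r (m * r).+1) (wVbar s 0)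
      (wquot F r (m * r).+1) (gL g 0) id (@rho 0) t)).
  apply: (@tensor_linear_ext _ (wquot F r (m * r).+1) (wVbar s 0) (gL g r.-1)).
  - exact: comp_linear (rhoL _ rr) gL'.
  - exact: comp_linear gphirL rhoT.
  move=> q v; rewrite (tmapE _ _ (@id_linear _ _) (rhoL 0 r0)).
  have [cL cb] := cB r.-1 rr; apply: (bij_inj cb).
  rewrite -[q]wrepK -(divpK (wrep_dvd q)) (corr_gphirE r1 m0 sF) rhoE.
  rewrite [LHS](coord_polyact r1 m0 DP) // Dr wclsZ // tensZl (linear_mapZ gphirL).
  by rewrite (linear_mapZ cL) cR.
exists s => //; exists rho; split; last exact: gE.
- move=> k kr; split; first exact: rhoL.
  have [cL [d cd dc]] := cB k kr; have [_ Db] := DP k kr.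
  apply: (eq_bij (f := d \o D k)) => [|q]; last by rewrite /= -rhoE cd.
  by apply: bij_comp Db; exists (@c k).
- move=> k kr v; have [cL cb] := cB k kr; apply: (bij_inj cb).
  rewrite (corr_gpi1 sP) // rhoE [LHS](coordV_cls r1 m0 gP cP) //; last exact: valP.
  by rewrite /generic_map; congr (c _ (gpi1 _ _)); apply: valKd.
- move=> k kr l; have [cL cb] := cB k (ltnW kr); apply: (bij_inj cb).
  by rewrite rhoE [LHS]Di // cphi.
Qed.

(** * Equivalence classes *)

Section GenericEquivalence.
Variables (F : fieldType) (r m : nat) (E : lmodType {poly F}) (V : filtration r E).
Hypothesis r0 : (0 < r)%N.
Implicit Types g : generic_data m V.

Let rr : (r.-1 < r)%N. Proof. by rewrite prednK. Qed.

Lemma generic_equiv_refl g : generic_equiv_on g g.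
Proof.
exists (fun k => id); split=> // [k kr|t]; first by split=> //; exists id.
by rewrite tmap_id.
Qed.

Lemma generic_equiv_sym g g' : generic_equiv_on g g' -> generic_equiv_on g' g.
Proof.
case=> sigma [sL spi sphi sphir].
pose tau k (l' : gL g' k) : gL g k := xget 0 [set l | sigma k l = l']%classic.
have stK k : (k < r)%N -> cancel (tau k) (sigma k).
  move=> kr l'; have [_ [d _ dc]] := sL k kr.
  by rewrite /tau; case: xgetP => [//|/(_ (d l'))[]] /=.
have sI k (kr : (k < r)%N) := bij_inj (sL k kr).2.
have tL k : (k < r)%N -> linear (tau k).
  by move=> kr p x y; apply: (sI k kr); rewrite (sL k kr).1 !stK.
exists tau; split.
- move=> k kr; split; first exact: tL.
  by exists (sigma k) => [|l]; [exact: stK | apply: (sI k kr); rewrite stK].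
- by move=> k kr v; apply: (sI k kr); rewrite stK // spi.
- move=> k kr l'; have kr' := ltnW kr.
  by apply: (sI k kr'); rewrite stK // sphi // stK.
move=> t; apply: (sI _ rr); rewrite stK // sphir; congr gphir.
rewrite tmap_comp //; [|exact: tL|exact: (sL 0 r0).1].
rewrite -[LHS]tmap_id; congr (tmap _ _ t); apply: funext => l /=; exact/esym/stK.
Qed.

Lemma generic_equiv_trans g g' g'' :
  generic_equiv_on g g' -> generic_equiv_on g' g'' -> generic_equiv_on g g''.
Proof.
move=> [sigma [sL spi sphi sphir]] [tau [tL tpi tphi tphir]].
exists (fun k => tau k \o sigma k); split.
- move=> k kr; have [sl sb] := sL k kr; have [tl tb] := tL k kr.
  by split; [exact: comp_linear | exact: bij_comp].
- by move=> k kr v; rewrite /= spi ?tpi.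
- by move=> k kr l; rewrite /= sphi ?tphi.
move=> t; rewrite /= sphir tphir; congr gphir.
by rewrite tmap_comp //; [exact: (sL 0 r0).1 | exact: (tL 0 r0).1].
Qed.
End GenericEquivalence.

Section Classes.
Variables (T T' : Type) (e : T -> T -> Prop) (e' : T' -> T' -> Prop) (f : T -> T').
Hypotheses (e'_refl : forall b, e' b b) (e'_sym : forall b c, e' b c -> e' c b).
Hypothesis e'_trans : forall b c d, e' b c -> e' c d -> e' b d.
Hypothesis eE : forall a b, e a b <-> e' (f a) (f b).
Hypothesis f_surj : forall b, exists a, e' (f a) b.

Lemma class_of_eq (S : Type) (R : S -> S -> Prop) :
  (forall a, R a a) -> (forall a b, R a b -> R b a) ->
  (forall a b c, R a b -> R b c -> R a c) ->
  forall a b, class_of R a = class_of R b <-> R a b.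
Proof.
move=> Rr Rs Rt a b; split=> [/(f_equal sval)/= ->|ab]; first exact: Rr.
apply: eq_exist => /=; apply: funext => c; apply: propext.
by split; apply: Rt => //; apply: Rs.
Qed.

Lemma class_of_surj (S : Type) (R : S -> S -> Prop) (c : classes R) :
  exists a, class_of R a = c.
Proof. by case: c => S' [a aE]; exists a; apply: eq_exist. Qed.

(** [eE] exhibits [e] as the pullback of [e'] along [f], so [e] inherits being an equivalence
    relation, and the same equivalence gives both well-definedness and injectivity of [Phi]. *)
Lemma classes_bij : exists Phi : classes e -> classes e', bijective Phi /\
  forall a, Phi (class_of e a) = class_of e' (f a).
Proof.
have e_eq := @class_of_eq T e (fun a => (eE a a).2 (e'_refl _))
  (fun a b ab => (eE b a).2 (e'_sym ((eE a b).1 ab)))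
  (fun a b c ab bc => (eE a c).2 (e'_trans ((eE a b).1 ab) ((eE b c).1 bc))).
have e'_eq := class_of_eq e'_refl e'_sym e'_trans.
pose rp c := sval (cid (class_of_surj (R := e) c)).
have rpK c : class_of e (rp c) = c by rewrite /rp; case: cid.
(* A class is a predicate, so a representative is chosen; [PhiE] shows independence of the
   choice. *)
pose Phi c := class_of e' (f (rp c)).
have PhiE a : Phi (class_of e a) = class_of e' (f a).
  by apply/e'_eq/eE/e_eq; rewrite rpK.
have PhiI : injective Phi.
  by move=> c d; rewrite -[c]rpK -[d]rpK !PhiE => /e'_eq/eE/e_eq.
have PhiS c' : exists c, Phi c = c'.
  have [b <-] := class_of_surj c'; have [a ab] := f_surj b.
  by exists (class_of e a); rewrite PhiE; apply/e'_eq.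
exists Phi; split=> //; pose Psi c' := sval (cid (PhiS c')).
have PsiK c' : Phi (Psi c') = c' by rewrite /Psi; case: cid.
by exists Psi => // c; apply: PhiI; rewrite PsiK.
Qed.
End Classes.

Section Structures.
Variables (F : fieldType) (r m : nat) (E : lmodType {poly F}).
Variables (nabla : linmap E E) (nu : nat -> {poly F}).
Hypotheses (r1 : (1 < r)%N) (m0 : (0 < m)%N).
Let r0 : (0 < r)%N. Proof. exact: ltnW. Qed.

(** Direct inversion would leave equalities of dependent pairs; an explicit equality of filtrations
    can be eliminated by case analysis. *)
Lemma generic_data_equivP (g g' : {V : filtration r E & generic_data m V}) :
  generic_data_equiv g g' <-> exists e : projT1 g = projT1 g',
    generic_equiv_on (eq_rect _ (@generic_data F r m E) (projT2 g) _ e) (projT2 g').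
Proof.
split=> [[V h h' hh]|]; first by exists erefl.
case: g g' => V h [V' h'] /= [e]; case: V' / e h' => h' /= hh.
exact: GenericDataEquiv.
Qed.

Lemma factorized_data_equivP (s s' : {V : filtration r E & factorized_data m V}) :
  is_factorized r m nabla nu s -> is_factorized r m nabla nu s' ->
  factorized_data_equiv s s' <->
  generic_data_equiv (correspondence r m s) (correspondence r m s').
Proof.
move=> sP s'P; split=> [ss'|/generic_data_equivP].
  case: ss' sP s'P => V t t' tt' /= sP s'P.
  exact/GenericDataEquiv/(correspondence_equiv r1 m0 sP s'P).
case: s s' sP s'P => V t [V' t'] /= sP s'P [e].
case: V' / e t' s'P => t' /= s'P tt'.
exact/FactorizedDataEquiv/(equiv_correspondence r1 m0 sP s'P).
Qed.

Lemma correspondence_classes :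
  (forall s : factorized_structure r m nabla nu,
     is_generic r m nabla nu (correspondence r m (sval s))) /\
  exists Phi : classes (factorized_structure_equiv r m nabla nu) ->
               classes (generic_structure_equiv r m nabla nu),
    bijective Phi /\
    forall (s : factorized_structure r m nabla nu)
           (g : generic_structure r m nabla nu),
      sval g = correspondence r m (sval s) ->
      Phi (class_of (factorized_structure_equiv r m nabla nu) s) =
      class_of (generic_structure_equiv r m nabla nu) g.
Proof.
have sg (s : factorized_structure r m nabla nu) :
    is_generic r m nabla nu (correspondence r m (sval s)).
  exact: (correspondence_generic r1 m0 (svalP s)).
split=> //.
pose f s : generic_structure r m nabla nu := exist _ _ (sg s).
have [|||||Phi [PhiB PhiE]] := @classes_bij _ _ (factorized_structure_equiv r m nabla nu)
  (generic_structure_equiv r m nabla nu) f.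
- by move=> [[V g] gP]; apply/GenericDataEquiv/generic_equiv_refl.
- move=> g g' /generic_data_equivP; case: g g' => [[V g] gP] [[V' g'] g'P] /= [e].
  case: V' / e g' g'P => g' g'P /= gg'.
  exact/GenericDataEquiv/(generic_equiv_sym r0 gg').
- move=> g g' g'' /generic_data_equivP gg' /generic_data_equivP; move: gg'.
  case: g g' g'' => [[V g] gP] [[V' g'] g'P] [[V'' g''] g''P] /= [e].
  case: V' / e g' g'P => g' g'P /= gg' [e'].
  case: V'' / e' g'' g''P => g'' g''P /= g'g''.
  exact/GenericDataEquiv/(generic_equiv_trans r0 gg' g'g'').
- by move=> s s'; apply: factorized_data_equivP; apply: svalP.
- move=> [[V g] gP]; have [s sP ss] := correspondence_surj r1 m0 gP.
  by exists (exist (is_factorized r m nabla nu) (existT _ V s) sP); apply: GenericDataEquiv.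
(* A generic structure with the same underlying data as [f s] equals it by proof irrelevance. *)
exists Phi; split=> // s g gs; rewrite PhiE; have -> // : f s = g.
by case: g gs => g gP /= gs; apply: eq_exist.
Qed.
End Structures.

Theorem proposition3p3 (R : realType) (X : curve R[i]) (Om : kaehler X)
    (D : effective_divisor X) (r : nat) (E : bundle X r)
    (nab : connection D Om E) (x : closed_point X) (z : X) (hz : ord x z = 1)
    (m : nat) (hm : D x = m) (hm2 : (2 <= m)%N) (hr2 : (2 <= r)%N)
    (nu : nat -> {poly R[i]})
    (hnu0 : (size (nu 0%N) <= m)%N)
    (hnu : forall k, (0 < k < r)%N -> (size (nu k) <= m.-1)%N)
    (hnu1 : (nu 1%N)`_0 != 0)
    (nabla : linmap (fiber E hz m) (fiber E hz m)) (hnabla : induced nab nabla) :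
  (forall s : factorized_structure r m nabla nu,
     is_generic r m nabla nu (correspondence r m (sval s))) /\
  exists Phi : classes (factorized_structure_equiv r m nabla nu) ->
               classes (generic_structure_equiv r m nabla nu),
    bijective Phi /\
    forall (s : factorized_structure r m nabla nu)
           (g : generic_structure r m nabla nu),
      sval g = correspondence r m (sval s) ->
      Phi (class_of (factorized_structure_equiv r m nabla nu) s) =
      class_of (generic_structure_equiv r m nabla nu) g.
Proof. exact: (correspondence_classes nabla nu hr2 (ltnW hm2)). Qed.
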